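(* Let $(\mathfrak{X}^{(t)})_{t\ge1}$ be a sequence of primitive coherent configurations with numbers of vertices $n\to\infty$ and $\rho/n^{2/3}\to0$, each equipped with a clique geometry $\mathcal{G}^{(t)}$, such that the sequence of clique geometries is asymptotically uniform and each $\mathfrak{X}^{(t)}$ has a vertex belonging to at most two cliques of $\mathcal{G}^{(t)}$. Then for all sufficiently large $t$, one of the following holds for $\mathfrak{X}=\mathfrak{X}^{(t)}$: (a) $\mathfrak{X}$ has rank three and is isomorphic to $\mathfrak{X}(T(m))$ or $\mathfrak{X}(L_2(m))$ for some $m$; (b) $\mathfrak{X}$ has rank four, $\mathfrak{X}$ has a non-symmetric nondominant color $i$, and $G(\mathfrak{X})$ is isomorphic to $T(m)$ for $m=n_i+2$.
   Context: A primitive coherent configuration (PCC) of rank $r$ on a finite set $V$, $|V|=n$, is a map $c:V\times V\to\{0,\ldots,r-1\}$ such that: color $0$ is exactly the set of diagonal pairs; for every color $i$ there is $i^*$ with $c(u,v)=i$ iff $c(v,u)=i^*$ (color $i$ is symmetric if $i^*=i$); for all $i,j,k$ there is $p^i_{jk}$ such that whenever $c(u,v)=i$, exactly $p^i_{jk}$ vertices $w$ satisfy $c(u,w)=j$, $c(w,v)=k$; and each digraph $(V,\{(u,v):c(u,v)=i\})$, $i\ne0$, is strongly connected. $\mathfrak{X}_i(u)=\{v:c(u,v)=i\}$, $n_i=|\mathfrak{X}_i(u)|$; colors are indexed so $n_1=\max_i n_i$, and $\rho=n-n_1-1$. A color $i\ne0$ is nondominant if $n_i<n/2$. $G(\mathfrak{X})$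 is the graph on $V$ where distinct $u,v$ are adjacent iff $c(u,v)$ is nondominant; $N(v)$ is the neighborhood of $v$ there. For nondominant $i$, $\lambda_i=|\mathfrak{X}_i(u)\cap N(v)|$ for any $u,v$ with $c(u,v)=i$. A clique geometry is a collection $\mathcal{G}$ of maximal cliques of $G(\mathfrak{X})$ such that every adjacent pair lies in exactly one clique of $\mathcal{G}$. The sequence of geometries is asymptotically uniform if the maximum of $||C\cap\mathfrak{X}_i(u)|/\lambda_i-1|$ over $C\in\mathcal{G}^{(t)}$, $u\in C$, nondominant $i$ with $C\cap\mathfrak{X}_i(u)\ne\emptyset$ tends to $0$. For a graph $X$, $\mathfrak{X}(X)$ is the configuration with one color on the diagonal, one on ordered pairs forming edges of $X$, and one on the other pairs of distinct vertices. $T(m)$ is the line graph of $K_m$; $L_2(m)$ is the line graph of $K_{m,m}$. *)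

(* Defs.v *)
From HB Require Import structures.
From mathcomp Require Import all_boot all_order all_algebra.

Set Implicit Arguments.
Unset Strict Implicit.
Unset Printing Implicit Defensive.

Record sgraph := SGraph {
  svertex :> finType;
  sadj : rel svertex;
  sadj_sym : symmetric sadj;
  sadj_irrefl : irreflexive sadj }.

Definition sgraph_iso (G H : sgraph) : Prop :=
  exists2 f : G -> H, bijective f & forall u v, sadj (f u) (f v) = sadj u v.

Definition sneighbors (G : sgraph) (v : G) : {set G} := [set w | sadj v w].

Definition clique (G : sgraph) (C : {set G}) : bool :=
  [forall u in C, forall v in C, (u != v) ==> sadj u v].

Definition maximal_clique (G : sgraph) (C : {set G}) : bool :=
  maxset (@clique G) C.

Definition edge_set (G : sgraph) : {set {set G}} :=
  [set [set p.1; p.2] | p : G * G & sadj p.1 p.2].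

Section LineGraph.
Variable G : sgraph.

Definition line_vertex : finType := {A : {set G} | A \in edge_set G}.

Definition line_adj : rel line_vertex :=
  fun A B => (A != B) && (val A :&: val B != set0).

Fact line_adj_sym : symmetric line_adj.
Proof. by move=> A B; rewrite /line_adj eq_sym setIC. Qed.

Fact line_adj_irrefl : irreflexive line_adj.
Proof. by move=> A; rewrite /line_adj eqxx. Qed.

Definition line_graph : sgraph := SGraph line_adj_sym line_adj_irrefl.
End LineGraph.

Fact neq_sym (T : eqType) : symmetric (fun x y : T => x != y).
Proof. by move=> x y; rewrite eq_sym. Qed.

Fact neq_irrefl (T : eqType) : irreflexive (fun x y : T => x != y).
Proof. by move=> x; rewrite eqxx. Qed.

Definition complete_graph (m : nat) : sgraph :=
  SGraph (@neq_sym 'I_m) (@neq_irrefl 'I_m).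

Definition biadj (m : nat) : rel ('I_m + 'I_m) := fun x y => is_inl x != is_inl y.

Fact biadj_sym (m : nat) : symmetric (@biadj m).
Proof. by move=> x y; rewrite /biadj eq_sym. Qed.

Fact biadj_irrefl (m : nat) : irreflexive (@biadj m).
Proof. by move=> x; rewrite /biadj eqxx. Qed.

Definition complete_bipartite_graph (m : nat) : sgraph :=
  SGraph (@biadj_sym m) (@biadj_irrefl m).

Definition triangular_graph (m : nat) : sgraph := line_graph (complete_graph m).

Definition lattice_graph (m : nat) : sgraph :=
  line_graph (complete_bipartite_graph m).

Record configuration := Configuration {
  vertex :> finType;
  rank : nat;
  color : vertex -> vertex -> 'I_rank }.

(* Color names carry no meaning, so an isomorphism may permute them. *)
Definition configuration_iso (X Y : configuration) : Prop :=
  exists2 f : X -> Y, bijective f &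
  exists2 phi : 'I_(rank X) -> 'I_(rank Y), bijective phi &
    forall u v, color (f u) (f v) = phi (color u v).

Definition graph_configuration (G : sgraph) : configuration :=
  @Configuration G 3 (fun u v =>
    if u == v then inord 0 else if sadj u v then inord 1 else inord 2).

(* On at least two vertices, strong connectivity makes every color occur, so
   that the rank is the number of colors and [star] and [intersection_number]
   are determined by the coloring. *)
Record pcc := PCC {
  pcc_configuration :> configuration;
  color_diag : forall u v : pcc_configuration,
    (color u v == 0 :> nat) = (u == v);
  star : 'I_(rank pcc_configuration) -> 'I_(rank pcc_configuration);
  color_star : forall i (u v : pcc_configuration),
    (color u v == i) = (color v u == star i);
  intersection_number :
    'I_(rank pcc_configuration) -> 'I_(rank pcc_configuration) ->
    'I_(rank pcc_configuration) -> nat;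
  color_coherent : forall i j k (u v : pcc_configuration), color u v = i ->
    #|[set w | (color u w == j) && (color w v == k)]|
      = intersection_number i j k;
  color_primitive : forall i : 'I_(rank pcc_configuration), i != 0 :> nat ->
    forall u v : pcc_configuration, connect (fun x y => color x y == i) u v }.

Section PCC.
Variable X : pcc.
Implicit Types (i j : 'I_(rank X)) (u v w : X) (C : {set X}).

Definition nb_vertices : nat := #|vertex X|.

Definition color_neighbors i u : {set X} := [set v | color u v == i].

(* The number of out-neighbors does not depend on the vertex: see [valencyE]. *)
Definition valency i : nat := \max_(u : X) #|color_neighbors i u|.

Lemma valencyE i u : #|color_neighbors i u| = valency i.
Proof.
have nbE v : #|color_neighbors i v|
    = intersection_number (color u u) i (star i).
  have cuv : color v v = color u u.
    apply/val_inj => /=.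
    have /eqP-> : color v v == 0 :> nat by rewrite color_diag.
    by have /eqP-> : color u u == 0 :> nat by rewrite color_diag.
  rewrite -(color_coherent _ _ cuv); apply: eq_card => w.
  by rewrite !inE -color_star andbb.
rewrite /valency nbE; apply/eqP; rewrite eqn_leq; apply/andP; split.
  by rewrite -[X in X <= _](nbE u); apply: leq_bigmax.
by apply/bigmax_leqP => v _; rewrite nbE.
Qed.

(* This is the valency of color 1 when the nonzero colors are indexed by
   decreasing valency; no indexing is imposed here. *)
Definition max_valency : nat := \max_(i : 'I_(rank X)) valency i.

Definition rho : nat := nb_vertices - max_valency - 1.

Definition nondominant i : bool :=
  (i != 0 :> nat) && ((valency i).*2 < nb_vertices).

Definition symmetric_color i : bool := star i == i.

Lemma valency_color_sym u v : valency (color v u) = valency (color u v).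
Proof.
have n_gt0 : 0 < #|vertex X| by apply/card_gt0P; exists u.
have sumE i : #|vertex X| * valency i = \sum_(x : X) \sum_(y : X) (color x y == i).
  rewrite -sum_nat_const; apply: eq_bigr => x _.
  by rewrite -(valencyE i x) -sum1_card big_mkcond; apply: eq_bigr => y _; rewrite inE; case: eqP.
apply/eqP; rewrite -(eqn_pmul2l n_gt0) !sumE exchange_big /=; apply/eqP.
have /eqP-> : color v u == star (color u v) by rewrite -color_star.
by apply: eq_bigr => x _; apply: eq_bigr => y _; rewrite -color_star.
Qed.

Definition nondominant_adj : rel X :=
  fun u v => (u != v) && nondominant (color u v).

Fact nondominant_adj_sym : symmetric nondominant_adj.
Proof.
move=> u v; rewrite /nondominant_adj /nondominant (valency_color_sym u v).
by rewrite !color_diag (eq_sym v u).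
Qed.

Fact nondominant_adj_irrefl : irreflexive nondominant_adj.
Proof. by move=> u; rewrite /nondominant_adj eqxx. Qed.

Definition nondominant_graph : sgraph :=
  SGraph nondominant_adj_sym nondominant_adj_irrefl.

(* The cardinal is the same for all pairs of color [i]: see [lambdaE]. *)
Definition lambda i : nat :=
  \max_(p : X * X | color p.1 p.2 == i)
    #|color_neighbors i p.1 :&: sneighbors (p.2 : nondominant_graph)|.

Lemma lambdaE i u v : color u v = i ->
  #|color_neighbors i u :&: sneighbors (v : nondominant_graph)| = lambda i.
Proof.
move=> cuv.
have cardE (x y : X) : color x y = i ->
    #|color_neighbors i x :&: sneighbors (y : nondominant_graph)|
    = \sum_(j | nondominant j) intersection_number i i (star j).
  move=> cxy; rewrite -sum1_card.
  rewrite (partition_big (fun w : X => color y w) nondominant) /=; last first.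
    by move=> w; rewrite !inE /= => /and3P[].
  apply: eq_bigr => j ndj; rewrite sum1_card -(color_coherent _ _ cxy).
  apply: eq_card => w; rewrite unfold_in /= !inE -color_star /nondominant_adj.
  case: (eqVneq (color y w) j) => [cyw|]; rewrite ?andbF // !andbT.
  rewrite /= /nondominant_adj cyw ndj -(color_diag y w) cyw.
  by case/andP: ndj => -> _; rewrite !andbT.
apply/eqP; rewrite eqn_leq; apply/andP; split; last first.
  apply/bigmax_leqP => -[x y] /= /eqP cxy.
  by rewrite (cardE _ _ cxy) (cardE _ _ cuv).
apply: (bigmax_sup (u, v)) => //=; exact/eqP.
Qed.

Definition clique_geometry (GG : {set {set X}}) : Prop :=
  (forall C, C \in GG -> maximal_clique (C : {set nondominant_graph})) /\
  (forall u v, nondominant_adj u v ->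
     exists! C, C \in GG /\ (u \in C /\ v \in C)).

Definition cliques_at (GG : {set {set X}}) u : {set {set X}} :=
  [set C in GG | u \in C].

End PCC.

From mathcomp Require Import all_classical all_reals all_analysis.
Import Order.TTheory GRing.Theory Num.Theory numFieldNormedType.Exports.

Local Open Scope classical_set_scope.
Local Open Scope ring_scope.

(* The division by [lambda i] is total: if [lambda i = 0], the deviation is 1,
   which is not small either. *)
Definition uniformity_deviations (R : realType) (X : pcc)
    (GG : {set {set X}}) : set R :=
  fun d => exists (C : {set X}) (u : X) (i : 'I_(rank X)),
    [/\ C \in GG, u \in C, nondominant i,
        (C :&: color_neighbors i u)%SET != finset.set0 &
        d = `| #|(C :&: color_neighbors i u)%SET|%:R / (lambda i)%:R - 1 | ].

Definition is_maximum (R : realType) (S : set R) (d : R) : Prop :=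
  S d /\ ubound S d.

(* The maximum must exist, so the set of deviations is nonempty for large [t].
   For a clique geometry on at least three vertices, this set is nonempty if and
   only if the rank is at least three: rank two has no nondominant color. *)
Definition asymptotically_uniform (R : realType) (X : nat -> pcc)
    (GG : forall t, {set {set X t}}) : Prop :=
  exists d : nat -> R,
    (\forall t \near \oo, is_maximum (uniformity_deviations (GG t)) (d t)) /\
    d t @[t --> \oo] --> (0 : R).

(* Main.v *)
Require Import Defs.
From mathcomp Require Import all_boot all_order all_algebra.
From mathcomp Require Import zify lra.

(* Primitivity gives mu <= rho^2 / n_1 and n_i >= n_1 / rho, where mu is the
   number of common neighbors of two non-adjacent vertices of G(X); so
   rho = o(n^(2/3)) makes mu negligible against every n_i. The number of
   vertices of X_j(u) adjacent to a given v in X_i(u) is then large exactly when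
   color j occurs at u in the clique through u and v. Hence the sets of colors
   that the cliques at u exhibit are the same for all u, namely those of the
   two cliques at the special vertex. Either these two sets are equal, and
   every vertex lies in exactly two cliques, each of which exhibits all the
   nondominant colors; or they are disjoint, and then the converse of a color
   of one set lies in the other, which is impossible in a clique on three
   vertices.

   So G(X) is the line graph of the graph H of the cliques, in which any two
   disjoint edges are joined by exactly mu >= 1 edges. Such an H of large
   minimum degree is complete or complete bipartite. In both cases the
   intersection numbers of the dominant color determine, at each vertex, how
   the colors are distributed over the cliques, which leaves at most two
   nondominant colors, and exactly one if H is bipartite; if there are two,
   the three pairs of a triangle of G(X) not contained in a clique of the
   geometry force them to be converse to each other. *)

Set Implicit Arguments.
Unset Strict Implicit.
Unset Printing Implicit Defensive.

(** * Graphs with a constant number of edges between disjoint edges *)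

Section CrossRegular.
Variables (T : finType) (e : rel T) (mu : nat).
Hypotheses (e_sym : symmetric e) (e_irr : irreflexive e) (mu_gt0 : 0 < mu).
Hypothesis e_deg : forall x (s : seq T), size s <= 6 -> exists2 y, e x y & y \notin s.
Hypothesis e_cross : forall a b c d, e a b -> e c d ->
  [/\ a != c, a != d, b != c & b != d] -> e a c + e a d + e b c + e b d = mu.

Let e_neq a b : e a b -> a != b.
Proof. by apply: contraTneq => ->; rewrite e_irr. Qed.

(** The edge [uw] is chosen disjoint from the triangle. Comparing it with the three sides shows that
    [x], [y] and [z] have equally many neighbors in [{u, w}], namely half of [mu]. If that number is
    1, two of them share their neighbor, which gives two triangles on a common edge and so [2 < mu];
    hence it is 2. *)
Lemma cross_regular_triangle x y z : e x y -> e y z -> e x z -> mu = 4.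
Proof.
move=> xy yz xz.
(* Two triangles [pqs] and [pqr] on a common edge: the disjoint edges [sp] and [rq] are joined by
   [pq], [pr] and [sq]. *)
have diamond p q r s : e s p -> e s q -> e p q -> e p r -> e q r -> r != s ->
    2 < mu.
  move=> sp sq pq pr qr rs.
  have rq : e r q by rewrite e_sym.
  have := e_cross sp rq.
  have -> : e p q by [].
  have -> : e p r by [].
  have -> : e s q by [].
  rewrite eq_sym rs (e_neq sq) (e_neq pq) (e_neq pr).
  by move=> /(_ (And4 isT isT isT isT)) <-; case: (e s r).
have [u xu] := e_deg x (s := [:: y; z]) isT.
rewrite !inE !negb_or => /andP[uy uz].
have [w uw] := e_deg u (s := [:: x; y; z]) isT.
rewrite !inE !negb_or => /and3P[wx wy wz].
have ux := e_neq xu; rewrite eq_sym in ux.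
have := e_cross xy uw; rewrite (eq_sym x) (eq_sym x w) (eq_sym y) (eq_sym y w).
rewrite ux wx uy wy => /(_ (And4 isT isT isT isT)).
have := e_cross yz uw; rewrite (eq_sym z) (eq_sym z w) (eq_sym y) (eq_sym y w).
rewrite uz wz uy wy => /(_ (And4 isT isT isT isT)).
have := e_cross xz uw; rewrite (eq_sym x) (eq_sym x w) (eq_sym z) (eq_sym z w).
rewrite ux wx uz wz => /(_ (And4 isT isT isT isT)).
have D p q r s : e p q -> e p r -> e q r -> e p s -> e q s -> r != s -> 2 < mu.
  by move=> pq pr qr ps qs; apply: (@diamond p q r s) => //; rewrite e_sym.
have yx : e y x by rewrite e_sym.
have zx : e z x by rewrite e_sym.
have zy : e z y by rewrite e_sym.
rewrite eq_sym in uy; rewrite eq_sym in uz; rewrite eq_sym in wx.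
rewrite eq_sym in wy; rewrite eq_sym in wz; rewrite eq_sym in ux.
move: (D x y z u xy xz yz) (D x z y u xz xy zy) (D y z x u yz yx zx).
move: (D x y z w xy xz yz) (D x z y w xz xy zy) (D y z x w yz yx zx).
rewrite ux uy uz wx wy wz xu; clear -mu_gt0.
case: (e x w); case: (e y u); case: (e y w); case: (e z u); case: (e z w) => /=; lia.
Qed.

(** Between disjoint edges at [b] and at [c] there are only four pairs, so [mu = 4] makes all of
    them adjacent. *)
Lemma cross_regular_complete : mu = 4 -> forall x y, x != y -> e x y.
Proof.
move=> mu4 b c bc.
have [b' bb'] := e_deg b (s := [:: c]) isT.
rewrite !inE => b'c.
have [c' cc'] := e_deg c (s := [:: b; b']) isT.
rewrite !inE !negb_or => /andP[c'b c'b'].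
rewrite eq_sym in c'b; rewrite eq_sym in c'b'.
have := e_cross bb' cc' (And4 bc c'b b'c c'b').
rewrite mu4; case: (e b c) => //.
by case: (e b c'); case: (e b' c); case: (e b' c').
Qed.

(** Without triangles, a vertex sees at most one end of an edge, so [mu] is 1 or 2. The value 2
    makes every vertex adjacent to exactly one end of each edge, and adjacency to [a] is then the
    bipartition. *)
Lemma cross_regular_bipartite :
  (forall x y z, e x y -> e y z -> ~~ e x z) ->
  forall a x y, e x y = (e a x != e a y).
Proof.
move=> tri.
have cross1 a b c d : e a b -> e c d -> a != c -> a != d -> b != c -> b != d ->
    e a c + e b c <= 1 /\ e a d + e b d <= 1 /\
    (e a c + e b c) + (e a d + e b d) = mu.
  move=> ab cd ac ad bc bd; have := e_cross ab cd (And4 ac ad bc bd).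
  have := tri a b c ab; have := tri a b d ab.
  case: (e a c); case: (e b c); case: (e a d); case: (e b d) => //= H1 H2 H;
  try by [have := H1 isT|have := H2 isT]; lia.
have mu2 b c d f : e b c -> e c d -> e d f -> e b f -> b != d -> c != f -> 1 < mu.
  move=> bc cd df bf bd cf.
  have fd : e f d by rewrite e_sym.
  have := @cross1 b c f d bc fd; rewrite cd bf.
  by rewrite (e_neq bf) bd cf (e_neq cd) => /(_ isT isT isT isT)[_ [_ <-]]; lia.
have [mu1|mu_n1] := eqVneq mu 1.
  (* [mu = 1] forbids 4-cycles. Given a path [f b a c] and two further neighbors [d], [d'] of [c],
     the only pair that can join [bf] to [cd] is [fd], and likewise [fd'] for [cd']; then [c d f d']
     is a 4-cycle. *)
  move=> a x y; exfalso.
  have C4 b c d f : e b c -> e c d -> e d f -> b != d -> c != f -> ~~ e b f.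
    by move=> bc cd df bd cf; apply/negP => /(mu2 b c d f bc cd df)/(_ bd cf); rewrite mu1.
  have [b ab _] := e_deg a (s := [::]) isT.
  have [c ac] := e_deg a (s := [:: b]) isT; rewrite !inE => cb.
  have [d cd] := e_deg c (s := [:: a]) isT; rewrite !inE => da.
  have [d' cd'] := e_deg c (s := [:: a; d]) isT; rewrite !inE negb_or => /andP[d'a d'd].
  have [f bf] := e_deg b (s := [:: a]) isT; rewrite !inE => fa.
  have ba : e b a by rewrite e_sym.
  have ca : e c a by rewrite e_sym.
  have nbc : ~~ e b c by apply: tri ba ac.
  have nfc : ~~ e f c.
    rewrite e_sym; apply: (C4 c a b f) => //; first by rewrite eq_sym in fa.
  have fd g : e c g -> g != a -> e f g.
    move=> cg ga.
    have nbg : ~~ e b g by apply: (C4 b a c g) => //; rewrite eq_sym.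
    have bg : b != g by apply: contraNneq nbc => ->; rewrite e_sym.
    have fg : f != g by apply: contraNneq nbg => <-.
    have fc : f != c by apply: contraNneq nbc => <-.
    have := e_cross bf cg; rewrite eq_sym cb bg fc fg.
    rewrite (negbTE nbg) (negbTE nbc) (negbTE nfc) => /(_ (And4 isT isT isT isT)).
    by case: (e f g) => //; rewrite mu1.
  have df : e d f by rewrite e_sym fd.
  have cf : c != f by apply: contraNneq nbc => ->.
  have dd' : d != d' by rewrite eq_sym.
  by have := C4 c d f d' cd df (fd _ cd' d'a) cf dd'; rewrite cd'.
have edge_split a b c : e a b -> e a c = ~~ e b c.
  move=> ab; case: (eqVneq c a) => [->|ca]; first by rewrite e_irr e_sym ab.
  case: (eqVneq c b) => [->|cb]; first by rewrite e_irr ab.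
  have [d cd] := e_deg c (s := [:: a; b]) isT.
  rewrite !inE negb_or => /andP[da db].
  have := @cross1 a b c d ab cd.
  rewrite eq_sym ca eq_sym da eq_sym cb eq_sym db => /(_ isT isT isT isT).
  by case: (e a c); case: (e b c); case: (e a d); case: (e b d) => //=; lia.
move=> a x y.
case: (boolP (e x y)) => xy.
  by rewrite ![e a _]e_sym (edge_split _ _ a xy); case: (e y a).
case: (boolP (e a x)) => ax.
  by rewrite (edge_split _ _ y ax) xy.
case: (boolP (e a y)) => ay //=.
by move: ax; rewrite (edge_split _ _ x ay) e_sym (negbTE xy).
Qed.

Lemma cross_regular_graph :
  (forall x y, x != y -> e x y) \/
  exists side : pred T, forall x y, e x y = (side x != side y).
Proof.
have [/existsP[x /existsP[y /existsP[z /and3P[xy yz xz]]]]|tri] :=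
  boolP [exists x, exists y, exists z, [&& e x y, e y z & e x z]].
  by left; apply/cross_regular_complete/(cross_regular_triangle xy yz xz).
case: (pickP T) => [a _|T0]; last by left=> x; have := T0 x.
right; exists (e a) => x y; apply: cross_regular_bipartite => {}x {}y z xy yz.
apply: contra tri => xz.
by apply/existsP; exists x; apply/existsP; exists y; apply/existsP; exists z; apply/and3P.
Qed.
End CrossRegular.

Lemma connect_exit (T : finType) (e : rel T) (P : pred T) x y :
  connect e x y -> P x -> ~~ P y -> exists a b, [/\ e a b, P a & ~~ P b].
Proof.
move=> /connectP[p + ->] {y}; elim: p x => [|y p IHp] x /=.
  by move=> _ Px; rewrite Px.
move=> /andP[exy pth] Px nP; case: (boolP (P y)) => Py; first exact: (IHp y).
by exists x, y.
Qed.

(** * Counting in a primitive coherent configuration *)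

Section PccCounts.
Variable X : pcc.
Implicit Types (i j : 'I_(rank X)) (u v w : X) (C : {set X}).

Definition nbr v : {set X} := [set w | nondominant_adj v w].

(** The number of [j]-neighbors [w] of [u] adjacent to [v] when [color u v = i]; [star] appears
    because [k] is read from [v] to [w]. With [j = i] nondominant it is [lambda i]. *)
Definition nbr_count i j : nat :=
  \sum_(k | nondominant k) intersection_number i j (star k).

Lemma nbr_countE j u v :
  #|color_neighbors j u :&: nbr v| = nbr_count (color u v) j.
Proof.
rewrite -sum1_card (partition_big (color v) (@nondominant X)) /=; last first.
  by move=> w; rewrite !inE => /and3P[].
apply: eq_bigr => k ndk.
rewrite sum1_card -(color_coherent _ _ (erefl (color u v))).
apply: eq_card => w; rewrite unfold_in /= !inE -color_star /nondominant_adj.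
case: (eqVneq (color v w) k) => [cvw|]; rewrite ?andbF // !andbT.
rewrite cvw ndk -(color_diag v w) cvw.
by case/andP: ndk => -> _; rewrite !andbT.
Qed.

Lemma nbr_sym u v : (u \in nbr v) = (v \in nbr u).
Proof. by rewrite !inE; exact: nondominant_adj_sym. Qed.

Lemma nbr_neq u v : v \in nbr u -> u != v.
Proof. by rewrite inE => /andP[]. Qed.

Lemma nbr_nondominant u v : v \in nbr u -> nondominant (color u v).
Proof. by rewrite inE => /andP[]. Qed.

Lemma mem_nbr i u v : nondominant i -> color u v = i -> v \in nbr u.
Proof.
move=> ndi cuv; rewrite inE /nondominant_adj cuv ndi andbT.
by rewrite -color_diag cuv; case/andP: ndi.
Qed.

Lemma sum_valency : 0 < nb_vertices X -> \sum_(i : 'I_(rank X)) valency i = nb_vertices X.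
Proof.
case/card_gt0P => u _; rewrite /nb_vertices -sum1_card.
rewrite (partition_big (color u) xpredT) //=; apply: eq_bigr => i _.
by rewrite -(valencyE i u) -sum1_card; apply: eq_bigl => v; rewrite inE.
Qed.

Lemma valency_diag u : valency (color u u) = 1.
Proof.
rewrite -(valencyE _ u) -(cards1 u); apply: eq_card => v; rewrite !inE.
apply/eqP/eqP => [E|-> //].
by apply/esym/eqP; rewrite -color_diag E color_diag.
Qed.

Lemma color_zeroE u j : (j == 0 :> nat) = (j == color u u).
Proof. by rewrite -val_eqE /=; congr (_ == _); apply/esym/eqP; rewrite color_diag. Qed.

(** A color of largest valency has valency [n - rho - 1], which is at least [n / 2]; the other
    nondiagonal colors share the remaining [rho] vertices, at most a quarter of all. *)
Lemma dominant_color : 8 <= nb_vertices X -> 4 * rho X <= nb_vertices X ->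
  exists d : 'I_(rank X), [/\ d != 0 :> nat,
    valency d + rho X + 1 = nb_vertices X &
    forall i, nondominant i = (i != 0 :> nat) && (i != d)].
Proof.
move=> n8 rho4; have n_gt0 : 0 < nb_vertices X by lia.
have := n_gt0; case/card_gt0P => u0 _.
have [|d _ dmax] := @eq_bigmax_cond 'I_(rank X) xpredT (fun i => valency i).
  by apply/card_gt0P; exists (color u0 u0).
have rhoE : rho X = nb_vertices X - valency d - 1.
  by rewrite /rho /max_valency -dmax; congr (_ - _ - _); apply: eq_bigl.
have zeroE := color_zeroE u0.
have d0 : d != color u0 u0.
  by apply/eqP => dE; move: rhoE; rewrite dE valency_diag; clear -n8 rho4; lia.
have := sum_valency n_gt0; rewrite (bigD1 (color u0 u0)) //= valency_diag.
rewrite (bigD1 d) //= => sumE.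
have rhoS : rho X = \sum_(i | (i != color u0 u0) && (i != d)) valency i.
  by rewrite rhoE -sumE -subnDA [X in _ - X]addnC addnA addKn.
have nE : valency d + rho X + 1 = nb_vertices X by rewrite rhoS -sumE addnC.
exists d; split; [by rewrite zeroE | by [] |].
clear sumE dmax; move=> i; rewrite /nondominant zeroE; case: (eqVneq i (color u0 u0)) => //= i0.
case: (eqVneq i d) => [->|id]; first by clear -nE rho4 n8; lia.
have : valency i <= rho X by rewrite rhoS (bigD1 i) ?i0 //= leq_addr.
by clear -nE rho4 n8; lia.
Qed.
End PccCounts.

(** * Primitivity estimates for the dominant color and the graph of nondominant pairs *)

Section Dominant.
Variables (X : pcc) (d : 'I_(rank X)).
Implicit Types (i j : 'I_(rank X)) (u v w : X) (C : {set X}).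
Hypotheses (d_neq0 : d != 0 :> nat)
  (valency_d : valency d + rho X + 1 = nb_vertices X)
  (nondominantE : forall i, nondominant i = (i != 0 :> nat) && (i != d)).

Lemma nbrE u v : (v \in nbr u) = (u != v) && (color u v != d).
Proof.
by rewrite inE /nondominant_adj nondominantE color_diag; case: (u != v).
Qed.

Lemma dominant_neq u v : color u v = d -> u != v.
Proof. by move=> cuv; rewrite -color_diag cuv. Qed.

Lemma card_nbr u : #|nbr u| = rho X.
Proof.
have : #|nbr u :|: color_neighbors d u :|: [set u]| = nb_vertices X.
  rewrite /nb_vertices -cardsT; congr #|pred_of_set _|; apply/setP => v.
  by rewrite in_setU in_setU nbrE !inE [u == v]eq_sym; case: (v == u); case: (color u v == d).
rewrite [_ :|: [set u]]setUC cardsU1 cardsU valencyE.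
rewrite (_ : nbr u :&: _ = set0).
  rewrite cards0 in_setU nbrE eqxx !inE /=.
  by rewrite (negbTE (_ : color u u != d)); first lia;
     apply: contraNneq d_neq0 => <-; rewrite color_diag.
by apply/setP => v; rewrite in_setI nbrE !inE -andbA andNb andbF.
Qed.

Definition mu : nat := \sum_(j | nondominant j) nbr_count d j.

Lemma card_common_nbr u v : color u v = d -> #|nbr u :&: nbr v| = mu.
Proof.
move=> cuv; rewrite -sum1_card.
rewrite (partition_big (color u) (@nondominant X)) /=; last first.
  by move=> w; rewrite in_setI => /andP[/nbr_nondominant].
apply: eq_bigr => j ndj; rewrite sum1_card -cuv -nbr_countE.
apply: eq_card => w; rewrite unfold_in /= !in_setI [in RHS]inE.
case: (eqVneq (color u w) j) => [cuw|]; rewrite ?andbF // andbT.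
by rewrite (mem_nbr ndj cuw).
Qed.

(* A path of color [i] from [u] to a vertex of [color_neighbors d u] has to leave
   the closed neighborhood of [u]. *)
Lemma exit_nbr i u : 0 < valency d -> nondominant i ->
  exists x y, [/\ x \in nbr u, color x y = i & color u y = d].
Proof.
rewrite -(valencyE d u) => /card_gt0P[v]; rewrite inE => /eqP cuv ndi.
have /andP[i0 id] : (i != 0 :> nat) && (i != d) by rewrite -nondominantE.
have [||x [y [/eqP cxy cux /negPn/eqP cuy]]] :=
  @connect_exit _ _ (fun x => color u x != d) _ _ (color_primitive i0 u v).
- by apply: contraNneq d_neq0 => <-; rewrite color_diag.
- by rewrite cuv eqxx.
exists x, y; split => //; rewrite nbrE cux andbT.
by apply: contraNneq id => ux; rewrite -cxy -ux cuy.
Qed.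

Lemma mu_gt0 i : 0 < valency d -> nondominant i -> 0 < mu.
Proof.
move=> d_gt0 ndi; have [n0|] := posnP (nb_vertices X); first lia.
case/card_gt0P => u _; have [x [y [ux xy uy]]] := exit_nbr u d_gt0 ndi.
rewrite -(card_common_nbr uy); apply/card_gt0P; exists x.
by rewrite in_setI ux nbr_sym (mem_nbr ndi xy).
Qed.

(** Some intersection number from [d] to a nondominant color followed by [i] is positive, so every
    [d]-neighbor of [u] ends an [i]-arc starting at one of the [rho] neighbors of [u]. *)
Lemma valency_dominant_le i : nondominant i -> valency d <= valency i * rho X.
Proof.
move=> ndi; have [-> //|d_gt0] := posnP (valency d).
have [n0|] := posnP (nb_vertices X); first lia.
case/card_gt0P => u _; have [x [y [ux xy uy]]] := exit_nbr u d_gt0 ndi.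
rewrite -(valencyE d u) -sum1_card.
apply: (@leq_trans (\sum_(v in color_neighbors d u)
                      \sum_(w in nbr u) (color w v == i))).
  apply: leq_sum => v; rewrite inE => /eqP uv.
  have : 0 < #|[set w | (color u w == color u x) && (color w v == i)]|.
    rewrite (color_coherent _ _ uv) -(color_coherent _ _ uy).
    by apply/card_gt0P; exists x; rewrite inE xy !eqxx.
  case/card_gt0P => w; rewrite inE => /andP[/eqP uw /eqP wv].
  rewrite (bigD1 w) /= ?wv ?eqxx //.
  exact: mem_nbr (nbr_nondominant ux) uw.
rewrite exchange_big /= mulnC -(card_nbr u) -sum_nat_const.
apply: leq_sum => w _; rewrite -(valencyE i w) -sum1_card [in leqRHS]big_mkcond.
rewrite [in leqLHS]big_mkcond; apply: leq_sum => v _.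
by rewrite !inE; case: (color u v == d); case: (color w v == i).
Qed.

(** Count the paths of length two in the graph from [u] to its [d]-neighbors: [mu] for each end, and
    at most [rho ^ 2] in all. *)
Lemma mu_dominant_le : mu * valency d <= rho X ^ 2.
Proof.
have [n0|] := posnP (nb_vertices X); first lia.
case/card_gt0P => u _.
rewrite mulnC -(valencyE d u) -sum_nat_const.
apply: (@leq_trans (\sum_(v in color_neighbors d u)
                      \sum_(w in nbr u) (w \in nbr v))).
  apply: leq_sum => v; rewrite inE => /eqP uv.
  rewrite -(card_common_nbr uv) -sum1_card [in leqLHS]big_mkcond [in leqRHS]big_mkcond.
  by apply: leq_sum => w _; rewrite in_setI; case: (w \in nbr u); case: (w \in nbr v).
rewrite exchange_big /= expnS expn1 -{1}(card_nbr u) -sum_nat_const.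
apply: leq_sum => w _; rewrite -(card_nbr w) -sum1_card [in leqRHS]big_mkcond.
rewrite [in leqLHS]big_mkcond; apply: leq_sum => v _.
by rewrite nbr_sym; case: ifP => //; case: ifP.
Qed.

(* [mu d * valency d <= rho X ^ 2] and [valency d <= valency i * rho X], so
   [mu d / valency i] is at most [rho X ^ 3 / valency d ^ 2]. *)
Lemma mu_small i : 4 * rho X <= nb_vertices X -> 4 <= nb_vertices X ->
  400 * rho X ^ 3 <= nb_vertices X ^ 2 -> nondominant i ->
  100 * mu <= valency i.
Proof.
move=> n4 n8 rho3 ndi.
have := mu_dominant_le; have := valency_dominant_le ndi.
have : nb_vertices X <= 2 * valency d by lia.
move: rho3; rewrite !expnS !expn0 !muln1.
have [-> |rho_gt0] := posnP (rho X).
  move=> _ h1 _; rewrite muln0 leqn0 muln_eq0.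
  by case/orP => /eqP E; [rewrite E | lia].
set n := nb_vertices X in n4 n8 *; set r := rho X in n4 rho_gt0 *.
set q := valency d; set k := valency i; set m := mu => rho3 n2q qk mq.
have rrr : 0 < r * (r * r) by rewrite !muln_gt0 rho_gt0.
have nn : n * n <= 4 * (q * q) by nia.
have qq : m * (q * q) <= k * (r * (r * r)).
  rewrite mulnA; apply: leq_trans (leq_mul mq qk) _.
  by rewrite mulnCA leq_mul2l -mulnA leqnn orbT.
rewrite -(leq_pmul2r rrr); apply: leq_trans qq.
(* With [r = rho X]: [400 m r^3 <= m n^2 <= 4 m q^2 <= 4 k r^3], so the constant 400 is 4 times the
   100 wanted. *)
have H : m * (400 * (r * (r * r))) <= m * (4 * (q * q)).
  by rewrite leq_mul2l (leq_trans rho3 nn) orbT.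
by rewrite -(leq_pmul2l (isT : 0 < 4)); lia.
Qed.
End Dominant.

(** * The colors of the cliques at a vertex *)

Section Geometry.
Variables (X : pcc) (GG : {set {set X}}).
Implicit Types (i j k : 'I_(rank X)) (u v w : X) (C D : {set X}).
Hypothesis geo : clique_geometry GG.

Lemma geometry_adj C u v : C \in GG -> u \in C -> v \in C -> u != v ->
  v \in nbr u.
Proof.
move=> CG uC vC uv; have /maxsetp/forall_inP clC := geo.1 C CG.
have /forall_inP/(_ v vC)/implyP/(_ uv) := clC u uC.
by rewrite inE.
Qed.

Lemma geometry_max C w : C \in GG -> w \notin C ->
  exists c, [/\ c \in C, c != w & c \notin nbr w].
Proof.
move=> CG wC; have /maxsetP[clC maxC] := geo.1 C CG.
have [/existsP[c /and3P[cC cw cn]]|none] :=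
    boolP [exists c, [&& c \in C, c != w & c \notin nbr w]].
  by exists c.
have adjw c : c \in C -> nondominant_adj w c.
  move=> cC; have := none; rewrite negb_exists => /forallP/(_ c).
  rewrite cC /= negb_and !negbK (_ : c == w = false) /=; first by rewrite inE.
  by apply: contraNF wC => /eqP <-.
have clw : clique (w |: C : {set nondominant_graph X}).
  apply/forall_inP => x xC; apply/forall_inP => y yC; apply/implyP => xy.
  have {xC} [Ex|xC] := setU1P xC; have {yC} [Ey|yC] := setU1P yC.
  - by rewrite Ex Ey eqxx in xy.
  - by rewrite Ex; exact: adjw.
  - by rewrite Ey /= nondominant_adj_sym; exact: adjw.
  - by move/forall_inP: clC => /(_ x xC)/forall_inP/(_ y yC)/implyP/(_ xy).
have CE := maxC _ clw (subsetUr _ _).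
by move: wC; rewrite -[in X in _ \notin X]CE setU11.
Qed.

Lemma geometry_clique u v : v \in nbr u ->
  exists C, [/\ C \in GG, u \in C & v \in C].
Proof.
by rewrite inE => /(geo.2 u v)[C [[CG [uC vC]] _]]; exists C.
Qed.

Lemma geometry_uniq C D u v : C \in GG -> D \in GG -> u != v ->
  u \in C -> v \in C -> u \in D -> v \in D -> C = D.
Proof.
move=> CG DG uv uC vC uD vD; have := geometry_adj CG uC vC uv.
by rewrite inE => /(geo.2 u v)[E [_ uniE]]; rewrite -(uniE C) // -(uniE D).
Qed.

Lemma sum_cliques_at u v : v \in nbr u ->
  \sum_(C in cliques_at GG u) (v \in C) = 1.
Proof.
move=> uv; have [C [CG uC vC]] := geometry_clique uv.
rewrite (bigD1 C) /= ?inE ?CG ?uC // vC big1 // => D /andP[].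
rewrite inE => /andP[DG uD] DC; apply/eqP; rewrite eqb0.
by apply: contraNN DC => vD; apply/eqP; apply: (geometry_uniq DG CG (nbr_neq uv)).
Qed.

(** The cliques at [u], with [u] removed, partition the neighborhood of [u]. *)
Lemma card_cliques_at (B : {set X}) u : B \subset nbr u ->
  #|B| = \sum_(C in cliques_at GG u) #|C :&: B|.
Proof.
move=> sB; rewrite -sum1_card.
rewrite (eq_bigr (fun v => \sum_(C in cliques_at GG u) nat_of_bool (v \in C))).
  rewrite exchange_big /=; apply: eq_bigr => C _.
  rewrite -sum1_card big_mkcond [in RHS]big_mkcond; apply: eq_bigr => v _.
  by rewrite in_setI; case: (v \in B); case: (v \in C).
by move=> v vB; rewrite sum_cliques_at // (subsetP sB).
Qed.

Lemma color_neighbors_sub i u : nondominant i -> color_neighbors i u \subset nbr u.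
Proof.
by move=> ndi; apply/subsetP => v; rewrite [v \in color_neighbors _ _]inE => /eqP; exact: mem_nbr.
Qed.

Definition clique_color C u i : bool := C :&: color_neighbors i u != set0.

Lemma clique_colorP C u i :
  reflect (exists2 v, v \in C & color u v = i) (clique_color C u i).
Proof.
apply: (iffP (set0Pn _)) => [[v]|[v vC cuv]].
  by rewrite !inE => /andP[vC /eqP cuv]; exists v.
by exists v; rewrite !inE vC cuv eqxx.
Qed.

Lemma mem_clique_color C u v : v \in C -> clique_color C u (color u v).
Proof. by move=> vC; apply/clique_colorP; exists v. Qed.

Definition color_cliques i u : {set {set X}} :=
  [set C in cliques_at GG u | clique_color C u i].

Lemma valency_color_cliques i u : nondominant i ->
  valency i = \sum_(C in color_cliques i u) #|C :&: color_neighbors i u|.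
Proof.
move=> ndi; rewrite -(valencyE i u) (card_cliques_at (color_neighbors_sub u ndi)).
rewrite (bigID (fun C => clique_color C u i)) /=.
rewrite [X in _ + X]big1 ?addn0; last first.
  by move=> C /andP[_]; rewrite negbK => /eqP->; rewrite cards0.
by apply: eq_bigl => C; rewrite [in RHS]inE.
Qed.

Variable d : 'I_(rank X).
Hypotheses (d_neq0 : d != 0 :> nat)
  (valency_d : valency d + rho X + 1 = nb_vertices X)
  (nondominantE : forall i, nondominant i = (i != 0 :> nat) && (i != d))
  (d_gt0 : 0 < valency d).

(** By maximality [D] has a vertex [c] not adjacent to [v]; the neighbors of [v] in [D] are then
    common neighbors of [v] and [c]. *)
Lemma card_nbr_clique D v : D \in GG -> v \notin D -> #|nbr v :&: D| <= mu d.
Proof.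
move=> DG vD; have [c [cD cv cn]] := geometry_max DG vD.
have cvd : color v c = d.
  apply/eqP; move: cn; rewrite (nbrE nondominantE) negb_and negbK eq_sym.
  by rewrite (negbTE cv) negbK.
rewrite -(card_common_nbr cvd); apply: subset_leq_card.
apply/subsetP => w /setIP[vw wD]; rewrite in_setI vw /=.
apply: (geometry_adj DG cD wD); apply: contraNneq cn => ->; exact: vw.
Qed.

Variable i0 : 'I_(rank X).
Hypothesis nd_i0 : nondominant i0.

Let mu_gt0 : 0 < mu d.
Proof. exact: (mu_gt0 d_neq0 valency_d nondominantE d_gt0 nd_i0). Qed.

(** A single clique [A] at [u] would contain the closed neighborhood of [u], hence at least
    [rho + 1] vertices. A vertex [x] of [A] with a neighbor [y] outside would then have more than
    [rho] neighbors. *)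
Lemma two_le_card_cliques_at u : 2 <= #|cliques_at GG u|.
Proof.
have [x [y [ux cxy cuy]]] := exit_nbr d_neq0 nondominantE u d_gt0 nd_i0.
have [A [AG uA xA]] := geometry_clique ux.
rewrite ltnNge; apply/negP => le1.
have atA C : C \in cliques_at GG u -> C = A.
  by move=> Cu; apply: (card_le1_eqP le1); rewrite // inE AG uA.
have sub : nbr u \subset A.
  apply/subsetP => v /geometry_clique[C [CG uC vC]].
  by rewrite -(atA C) // inE CG uC.
have uy : y \notin nbr u by rewrite (nbrE nondominantE) cuy eqxx andbF.
have yA : y \notin A.
  apply: contraNN uy => yA; apply: (geometry_adj AG uA yA).
  exact: (dominant_neq d_neq0 cuy).
have xy := mem_nbr nd_i0 cxy.
have : y |: A :\ x \subset nbr x.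
  apply/subsetP => z; rewrite in_setU1 in_setD1 => /orP[/eqP-> //|/andP[zx zA]].
  by apply: (geometry_adj AG) => //; rewrite eq_sym.
move/subset_leq_card; rewrite (card_nbr d_neq0 valency_d nondominantE).
rewrite cardsU1 in_setD1 (negbTE yA) andbF /=.
have := cardsD1 x A; rewrite xA.
have : #|u |: nbr u| <= #|A| by apply: subset_leq_card; rewrite subUset sub1set uA.
rewrite cardsU1 (card_nbr d_neq0 valency_d nondominantE) (nbrE nondominantE) eqxx.
by rewrite /= => h1 h2 h3; clear -h1 h2 h3; lia.
Qed.

(** * Recognizing the colors of a clique from neighbor counts *)

Hypotheses (mu_small : forall i, nondominant i -> 100 * mu d <= valency i)
  (uniform : forall C u i, C \in GG -> u \in C -> nondominant i ->
     clique_color C u i ->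
     9 * lambda i <= 10 * #|C :&: color_neighbors i u| <= 11 * lambda i).

Lemma valency_lambda i u : nondominant i ->
  9 * (lambda i * #|color_cliques i u|) <= 10 * valency i
    <= 11 * (lambda i * #|color_cliques i u|).
Proof.
move=> ndi; rewrite [valency i](valency_color_cliques u ndi).
have sumE c : c * (lambda i * #|color_cliques i u|)
    = \sum_(C in color_cliques i u) c * lambda i.
  by rewrite sum_nat_const mulnA mulnC.
rewrite !sumE [10 * _]big_distrr /=.
have bnd C : C \in color_cliques i u ->
    9 * lambda i <= 10 * #|C :&: color_neighbors i u| <= 11 * lambda i.
  by rewrite !inE => /andP[/andP[CG uC] Ci]; exact: uniform.
by apply/andP; split; apply: leq_sum => C /bnd/andP[].
Qed.

Variable u0 : X.
Hypothesis u0_cliques : #|cliques_at GG u0| <= 2.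

Lemma card_color_cliques_u0 i : #|color_cliques i u0| <= 2.
Proof.
apply: leq_trans u0_cliques; apply: subset_leq_card.
by apply/subsetP => C; rewrite inE => /andP[].
Qed.

(** At most two cliques at [u0] exhibit [i], so [1000 mu <= 10 valency i <= 22 lambda i]. *)
Lemma lambda_large i : nondominant i -> 40 * mu d <= lambda i.
Proof.
move=> ndi; have := valency_lambda u0 ndi; have := mu_small ndi.
have := card_color_cliques_u0 i; move: #|_| (mu d) (lambda i) (valency i) => k m l n.
by clear; nia.
Qed.

(** Both numbers of cliques are [valency i / lambda i] up to a tenth, so [9 k' <= 11 k]. This rules
    out [k <= c < k'] for [c <= 2], since [9 (c + 1) > 11 c]. *)
Lemma color_cliques_le i u c : nondominant i -> c <= 2 ->
  #|color_cliques i u0| <= c -> #|color_cliques i u| <= c.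
Proof.
move=> ndi; have := lambda_large ndi.
have /andP[_ H1] := valency_lambda u0 ndi; have /andP[H2 _] := valency_lambda u ndi.
move: (leq_trans H2 H1) mu_gt0.
move: #|color_cliques i u| #|color_cliques i u0| (mu d) (lambda i) => k' k m l; clear.
move=> H m0 lm c2 kc; rewrite leqNgt; apply/negP => ck.
have l0 : 0 < l by lia.
have H3 : 9 * (l * k') <= 11 * (l * k) by [].
have : l * (9 * k') <= l * (11 * k) by lia.
rewrite leq_pmul2l //; lia.
Qed.

(* [v] has at most [mu d] neighbors in a clique that avoids it, and the vertices
   of [color_neighbors j u] lie in at most two cliques at [u]. *)
Lemma nbr_count_large C u v i j : C \in GG -> u \in C -> v \in C -> u != v ->
  color u v = i -> nondominant j ->
  (2 * mu d < nbr_count i j) = clique_color C u j.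
Proof.
move=> CG uC vC uv <- ndj; rewrite -nbr_countE.
case: (boolP (clique_color C u j)) => Cj.
  (* If [C] exhibits [j], all its [j]-neighbors of [u] other than [v] count; there are at least
     [36 mu - 1] of them. *)
  have sub : (C :&: color_neighbors j u) :\ v \subset color_neighbors j u :&: nbr v.
    apply/subsetP => w; rewrite in_setD1 !in_setI => /and3P[wv wC ->] /=.
    by apply: (geometry_adj CG) => //; rewrite eq_sym.
  apply: leq_trans (subset_leq_card sub).
  have := cardsD1 v (C :&: color_neighbors j u).
  have /andP[] := uniform CG uC ndj Cj; have := lambda_large ndj.
  have := leq_b1 (v \in C :&: color_neighbors j u); have := mu_gt0.
  move: (nat_of_bool _) #|_| #|_| (mu d) (lambda j) => b c c' m l; clear; lia.
apply/negbTE; rewrite -leqNgt.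
rewrite (@card_cliques_at _ u); last first.
  exact: subset_trans (subsetIl _ _) (color_neighbors_sub u ndj).
rewrite (bigID (fun D => D \in color_cliques j u)) /= addnC big1 ?add0n; last first.
  move=> D /andP[Du]; rewrite inE Du /= negbK => /eqP D0.
  by rewrite setIA D0 set0I cards0.
apply: (@leq_trans (\sum_(D in color_cliques j u) mu d)).
  rewrite [in leqRHS](eq_bigl (fun D => (D \in cliques_at GG u) && (D \in color_cliques j u))).
    apply: leq_sum => D /andP[]; rewrite !inE => /andP[DG uD] /andP[_ Dj].
    have vD : v \notin D.
      by apply: contraNN Cj => vD; rewrite (geometry_uniq CG DG uv).
    apply: leq_trans (card_nbr_clique DG vD); apply: subset_leq_card.
    by apply/subsetP => w; rewrite !in_setI => /and3P[-> _ ->].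
  by move=> D; rewrite [D \in color_cliques _ _]inE andbA andbb.
rewrite sum_nat_const leq_mul2r; apply/orP; right.
exact/color_cliques_le/card_color_cliques_u0.
Qed.

(** The left side involves neither [C] nor [u]: cliques that share one color, at whatever vertices,
    exhibit the same colors. *)
Lemma clique_color_nbr_count C u i j : C \in GG -> u \in C ->
  nondominant i -> nondominant j -> clique_color C u i ->
  (2 * mu d < nbr_count i j) = clique_color C u j.
Proof.
move=> CG uC ndi ndj /clique_colorP[v vC cuv].
by apply: (nbr_count_large CG uC vC) => //; exact: nbr_neq (mem_nbr ndi cuv).
Qed.

(** What has to be excluded is [C = {u}]: if a neighbor [x] of [u] is outside [C], maximality gives
    a vertex of [C] not adjacent to [x], which is not [u]. *)
Lemma geometry_has_color C u : C \in GG -> u \in C ->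
  exists2 i, nondominant i & clique_color C u i.
Proof.
move=> CG uC.
have [x [_ [ux _ _]]] := exit_nbr d_neq0 nondominantE u d_gt0 nd_i0.
suff [v vC uv] : exists2 v, v \in C & u != v.
  exists (color u v); last exact: mem_clique_color.
  exact: nbr_nondominant (geometry_adj CG uC vC uv).
have [xC|xC] := boolP (x \in C); first by exists x => //; exact: nbr_neq ux.
have [c [cC cx cn]] := geometry_max CG xC; exists c => //.
by apply: contraNneq cn => <-; rewrite nbr_sym.
Qed.

Lemma color_has_clique u i : nondominant i ->
  exists C, [/\ C \in GG, u \in C & clique_color C u i].
Proof.
move=> ndi; have : 0 < valency i by have := mu_small ndi; have := mu_gt0; clear; lia.
rewrite -(valencyE i u) => /card_gt0P[v]; rewrite inE => /eqP cuv.
have [C [CG uC vC]] := geometry_clique (mem_nbr ndi cuv).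
by exists C; split => //; apply/clique_colorP; exists v.
Qed.

Lemma card_geometry_ge C u : C \in GG -> u \in C -> 9 <= #|C|.
Proof.
move=> CG uC; have [i ndi Ci] := geometry_has_color CG uC.
have /andP[+ _] := uniform CG uC ndi Ci.
have := lambda_large ndi; have := mu_gt0.
have := subset_leq_card (subsetIl C (color_neighbors i u)).
move: #|_| #|_| (mu d) (lambda i) => a b m l; clear; lia.
Qed.

Lemma color_swap u v : color v u = star (color u v).
Proof. by apply/eqP; rewrite -color_star. Qed.

Lemma nondominant_star i : nondominant i -> nondominant (star i).
Proof.
move=> ndi; have [C [_ _ /clique_colorP[v _ cuv]]] := color_has_clique u0 ndi.
have := mem_nbr ndi cuv; rewrite -nbr_sym => /nbr_nondominant.
by rewrite color_swap cuv.
Qed.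

(** * Excluding two cliques with disjoint sets of colors *)

Section DisjointColors.
Variables A B : {set X}.
Hypotheses (AG : A \in GG) (BG : B \in GG) (u0A : u0 \in A) (u0B : u0 \in B)
  (atu0 : forall C, C \in GG -> u0 \in C -> C = A \/ C = B)
  (disj : forall i, nondominant i ->
     ~~ (clique_color A u0 i && clique_color B u0 i)).

Let colorB i : nondominant i -> clique_color B u0 i = ~~ clique_color A u0 i.
Proof.
move=> ndi; have := disj ndi; have [C [CG uC Ci]] := color_has_clique u0 ndi.
by have [EC|EC] := atu0 CG uC; rewrite EC in Ci; rewrite Ci ?andbT //= => /negbTE->.
Qed.

(** [B] exhibits at [u0] exactly the colors that [A] does not, so the nondominant colors fall into
    two classes, and largeness of [nbr_count] means being in the same class. *)
Let large_colorA i j : nondominant i -> nondominant j ->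
  (2 * mu d < nbr_count i j) = (clique_color A u0 i == clique_color A u0 j).
Proof.
move=> ndi ndj; case: (boolP (clique_color A u0 i)) => Ai.
  by rewrite (clique_color_nbr_count AG u0A ndi ndj Ai); case: clique_color.
by rewrite (clique_color_nbr_count BG u0B ndi ndj) ?colorB //.
Qed.

Let same_colorA C u i j : C \in GG -> u \in C -> nondominant i -> nondominant j ->
  clique_color C u i -> clique_color C u j = (clique_color A u0 i == clique_color A u0 j).
Proof.
by move=> CG uC ndi ndj Ci; rewrite -large_colorA // (clique_color_nbr_count CG uC).
Qed.

(** Disjointness gives at most one clique exhibiting [i] at [u0], and [color_cliques_le] with bound
    1 carries this to every vertex. *)
Let one_clique i u C D : nondominant i -> C \in GG -> D \in GG ->
  u \in C -> u \in D -> clique_color C u i -> clique_color D u i -> C = D.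
Proof.
move=> ndi CG DG uC uD Ci Di.
have le1 : #|color_cliques i u0| <= 1.
  apply/card_le1_eqP => E F; rewrite !inE.
  move=> /andP[/andP[EG uE] Ei] /andP[/andP[FG uF] Fi].
  have := disj ndi.
  by have [EE|EE] := atu0 EG uE; have [EF|EF] := atu0 FG uF; subst => //;
     rewrite Ei Fi.
by apply: (card_le1_eqP (color_cliques_le u ndi (isT : 1 <= 2) le1));
   rewrite !inE ?CG ?DG ?uC ?uD ?Ci ?Di.
Qed.

(* Otherwise the clique through [u0] and its [i]-neighbors would be closed under
   [i]-arcs, against primitivity. *)
Let star_colorA i : nondominant i ->
  clique_color A u0 (star i) = ~~ clique_color A u0 i.
Proof.
move=> ndi.
suff: clique_color A u0 (star i) != clique_color A u0 i by do 2!case: clique_color.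
apply/negP => sameA.
have [C [CG uC Ci]] := color_has_clique u0 ndi.
have /andP[in0 _] : (i != 0 :> nat) && (i != d) by rewrite -nondominantE.
have : 0 < #|color_neighbors d u0| by rewrite valencyE.
case/card_gt0P => y; rewrite inE => /eqP uy.
have yC : y \notin C.
  apply/negP => yC; have := geometry_adj CG uC yC (dominant_neq d_neq0 uy).
  by rewrite (nbrE nondominantE) uy eqxx andbF.
have [||a [b [/eqP ab /andP[aC Ca]]]] := connect_exit
  (P := fun x => (x \in C) && clique_color C x i) (color_primitive in0 u0 y).
- by rewrite uC.
- by rewrite (negbTE yC).
(* The clique of the arc [ab] exhibits [i] at [a], so it is [C]. Hence [b] is in [C], where it sees
   [a] by the color [star i], of the class of [i]. *)
have [D [DG aD bD]] := geometry_clique (mem_nbr ndi ab).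
have Da : clique_color D a i by rewrite -ab mem_clique_color.
rewrite (one_clique ndi CG DG aC aD Ca Da) bD /=.
rewrite (same_colorA (i := star i) DG bD (nondominant_star ndi) ndi) ?sameA //.
by rewrite -ab -color_swap mem_clique_color.
Qed.

(* By [star_colorA], of any two vertices of [A] exactly one sees the other by a
   color that [A] has at [u0], and all pairs at a vertex of [A] behave alike. *)
Lemma disjoint_colors_false : False.
Proof.
have [v [w [vA wA [uv uw vw]]]] :
    exists v w, [/\ v \in A, w \in A & [/\ u0 != v, u0 != w & v != w]].
  have : 2 < #|A| by apply: leq_trans (card_geometry_ge AG u0A).
  rewrite (cardsD1 u0) u0A add1n ltnS => /card_gt1P[v [w []]].
  rewrite !in_setD1 => /andP[vu vA] /andP[wu wA] vw.
  by exists v, w; rewrite ![u0 == _]eq_sym.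
have nd x y : x \in A -> y \in A -> x != y -> nondominant (color x y).
  by move=> xA yA xy; exact: nbr_nondominant (geometry_adj AG xA yA xy).
pose ty x y := clique_color A u0 (color x y).
have tyE x y z : x \in A -> y \in A -> z \in A -> x != y -> x != z ->
    ty x y = ty x z.
  move=> xA yA zA xy xz; apply/(@eqP bool).
  rewrite -(same_colorA AG xA (nd _ _ xA yA xy) (nd _ _ xA zA xz)).
    exact: mem_clique_color.
  exact: mem_clique_color.
have tyN x y : x \in A -> y \in A -> x != y -> ty y x = ~~ ty x y.
  by move=> xA yA xy; rewrite /ty color_swap star_colorA // nd.
have := tyE _ _ _ u0A vA wA uv uw.
have := tyN _ _ u0A vA uv; have := tyN _ _ u0A wA uw; have := tyN _ _ vA wA vw.
have := tyE _ _ _ vA u0A wA; rewrite eq_sym => /(_ uv vw).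
have := tyE _ _ _ wA u0A vA; rewrite eq_sym [w == v]eq_sym => /(_ uw vw).
move: (ty u0 v) (ty u0 w) (ty v u0) (ty v w) (ty w u0) (ty w v).
by do 6!case.
Qed.
End DisjointColors.

(** If the two cliques at [u0] share a color [k], every color [j] occurs together with [k] in one of
    them, so [nbr_count k j] is large and [A] exhibits [j] too. Any other clique shares some color
    with [A], hence all. Sharing no color is impossible by [disjoint_colors_false]. *)
Lemma geometry_all_colors C u i : C \in GG -> u \in C -> nondominant i ->
  clique_color C u i.
Proof.
have /cards2P[A [B [_ atu0]]] : #|cliques_at GG u0| == 2.
  by rewrite eqn_leq u0_cliques two_le_card_cliques_at.
have : A \in cliques_at GG u0 by rewrite atu0 !inE eqxx.
have : B \in cliques_at GG u0 by rewrite atu0 !inE eqxx orbT.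
rewrite !inE => /andP[BG uB] /andP[AG uA].
have atP D : D \in GG -> u0 \in D -> D = A \/ D = B.
  move=> DG uD; have : D \in cliques_at GG u0 by rewrite inE DG.
  by rewrite atu0 !inE => /orP[]/eqP; [left|right].
have [/existsP[k /and3P[ndk Ak Bk]]|none] := boolP
    [exists k, [&& nondominant k, clique_color A u0 k & clique_color B u0 k]].
  have largek j : nondominant j -> 2 * mu d < nbr_count k j.
    move=> ndj; have [D [DG uD Dj]] := color_has_clique u0 ndj.
    by have [ED|ED] := atP D DG uD; subst D;
       rewrite (clique_color_nbr_count DG uD ndk ndj).
  have allA j : nondominant j -> clique_color A u0 j.
    by move=> ndj; rewrite -(clique_color_nbr_count AG uA ndk ndj) // largek.
  move=> CG uC ndi; have [j ndj Cj] := geometry_has_color CG uC.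
  rewrite -(clique_color_nbr_count CG uC ndj ndi Cj).
  by rewrite (clique_color_nbr_count AG uA ndj ndi) allA.
exfalso; apply: (disjoint_colors_false AG BG uA uB atP) => j ndj.
by apply: contra none => ABj; apply/existsP; exists j; rewrite ndj.
Qed.

(** Every clique at [u] exhibits [i0], so the bound on the cliques exhibiting [i0] bounds them
    all. *)
Lemma card_cliques_at_eq2 u : #|cliques_at GG u| = 2.
Proof.
apply/eqP; rewrite eqn_leq two_le_card_cliques_at andbT.
apply: leq_trans (color_cliques_le u nd_i0 (leqnn 2) (card_color_cliques_u0 i0)).
apply: subset_leq_card; apply/subsetP => C Cu; rewrite inE Cu.
by move: Cu; rewrite inE => /andP[CG uC]; rewrite geometry_all_colors.
Qed.
End Geometry.

(** * Geometries with two cliques at every vertex *)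

Section TwoCliques.
Variables (X : pcc) (GG : {set {set X}}) (d : 'I_(rank X)).
Implicit Types (i j k : 'I_(rank X)) (u v w : X) (C D : {set X}).
Hypotheses (geo : clique_geometry GG)
  (d_neq0 : d != 0 :> nat)
  (valency_d : valency d + rho X + 1 = nb_vertices X)
  (nondominantE : forall i, nondominant i = (i != 0 :> nat) && (i != d))
  (mu_gt0 : 0 < mu d)
  (two : forall u, #|cliques_at GG u| = 2)
  (all_colors : forall C u i, C \in GG -> u \in C -> nondominant i ->
     clique_color C u i)
  (large : forall C, C \in GG -> 9 <= #|C|).

Lemma cliques_at_pair u C D : C \in GG -> D \in GG -> C != D ->
  u \in C -> u \in D -> cliques_at GG u = [set C; D].
Proof.
move=> CG DG CD uC uD; apply/esym/eqP; rewrite eqEcard two cards2 CD andbT.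
by apply/subsetP => E; rewrite !inE => /orP[]/eqP->; rewrite ?CG ?DG ?uC ?uD.
Qed.

Lemma third_clique u C D E : C \in GG -> D \in GG -> C != D ->
  u \in C -> u \in D -> E \in GG -> u \in E -> E = C \/ E = D.
Proof.
move=> CG DG CD uC uD EG uE.
have : E \in cliques_at GG u by rewrite inE EG.
by rewrite (cliques_at_pair CG DG CD uC uD) !inE => /orP[]/eqP; [left|right].
Qed.

Lemma other_clique u C : C \in GG -> u \in C ->
  exists D, [/\ D \in GG, u \in D & C != D].
Proof.
move=> CG uC; have /card_gt0P[D] : 0 < #|cliques_at GG u :\ C|.
  by have := cardsD1 C (cliques_at GG u); rewrite two inE CG uC /= add1n => -[<-].
by rewrite !inE => /and3P[DC DG uD]; exists D; rewrite eq_sym.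
Qed.

Lemma geometry_at u : exists C D, [/\ C \in GG, D \in GG, C != D, u \in C & u \in D].
Proof.
have /card_gt0P[C] : 0 < #|cliques_at GG u| by rewrite two.
rewrite inE => /andP[CG uC]; have [D [DG uD CD]] := other_clique CG uC.
by exists C, D.
Qed.

Lemma sum_pair u C D (F : {set X} -> nat) : C \in GG -> D \in GG -> C != D ->
  u \in C -> u \in D -> \sum_(E in cliques_at GG u) F E = F C + F D.
Proof.
move=> CG DG CD uC uD; rewrite (cliques_at_pair CG DG CD uC uD).
by rewrite big_setU1 ?inE // big_set1.
Qed.

Lemma clique_cap_unique C D u v : C \in GG -> D \in GG -> C != D ->
  u \in C -> u \in D -> v \in C -> v \in D -> u = v.
Proof.
move=> CG DG CD uC uD vC vD; apply/eqP; apply: contraNT CD => uv.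
by apply/eqP; apply: (geometry_uniq geo CG DG uv).
Qed.

Lemma card_clique_cap C D : C \in GG -> D \in GG -> C != D ->
  #|C :&: D| = (C :&: D != set0).
Proof.
move=> CG DG CD; case: (set_0Vmem (C :&: D)) => [->|[u uCD]].
  by rewrite cards0 eqxx.
have -> : C :&: D = [set u].
  apply/setP => v; rewrite in_set1; apply/idP/eqP => [vCD|-> //].
  case/setIP: uCD => uC uD; case/setIP: vCD => vC vD.
  exact: (clique_cap_unique CG DG).
by rewrite cards1; apply/esym/eqP; rewrite eqb1; apply/set0Pn; exists u; rewrite inE.
Qed.

Lemma cliques_non_nbr u v C D : C \in GG -> D \in GG -> C != D ->
  v \in C -> v \in D -> u \notin C -> u \notin D -> color u v = d.
Proof.
move=> CG DG CD vC vD uC uD; apply/eqP; apply: contraNT uC => cuv.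
have uv : u != v by apply: contraNneq uD => ->.
have : v \in nbr u by rewrite (nbrE nondominantE) uv.
case/(geometry_clique geo) => E [EG uE vE].
have [EC|ED] := third_clique CG DG CD vC vD EG vE; first by rewrite -EC.
by rewrite -ED uE in uD.
Qed.

(** The neighbors of [v] lie in [C] or [D], and [v] itself is not a [j]-neighbor of [u], being at
    color [d]. *)
Lemma nbr_count_split u v C D j : C \in GG -> D \in GG -> C != D ->
  v \in C -> v \in D -> u \notin C -> u \notin D -> nondominant j ->
  nbr_count d j = #|C :&: color_neighbors j u| + #|D :&: color_neighbors j u|.
Proof.
move=> CG DG CD vC vD uC uD ndj.
have cuv := cliques_non_nbr CG DG CD vC vD uC uD.
rewrite -cuv -nbr_countE (card_cliques_at geo (subsetIr _ (nbr v))).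
rewrite (sum_pair _ CG DG CD vC vD).
have capE E : E \in GG -> v \in E ->
    E :&: (color_neighbors j u :&: nbr v) = E :&: color_neighbors j u.
  move=> EG vE; apply/setP => w; rewrite !in_setI; case: (boolP (w \in E)) => //= wE.
  case: (boolP (w \in color_neighbors j u)) => //=; rewrite inE => /eqP cuw.
  apply: (geometry_adj geo EG vE wE).
  apply: contraTneq ndj => vw; rewrite nondominantE -cuw -vw cuv eqxx.
  by rewrite andbF.
by rewrite !capE.
Qed.

Lemma card_clique_nbr u A B C : A \in GG -> B \in GG -> A != B ->
  u \in A -> u \in B -> C \in GG -> u \notin C ->
  #|C :&: nbr u| = (A :&: C != set0) + (B :&: C != set0).
Proof.
move=> AG BG AB uA uB CG uC.
rewrite (card_cliques_at geo (subsetIr C (nbr u))) (sum_pair _ AG BG AB uA uB).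
have capE E : E \in GG -> u \in E -> #|E :&: (C :&: nbr u)| = (E :&: C != set0).
  move=> EG uE; have EC : E != C by apply: contraNneq uC => <-.
  rewrite -(card_clique_cap EG CG EC); apply: eq_card => w.
  rewrite !in_setI; case: (boolP (w \in E)) => //= wE.
  case: (boolP (w \in C)) => //= wC; apply: (geometry_adj geo EG uE wE).
  by apply: contraNneq uC => ->.
by rewrite !capE.
Qed.

(** * The graph of the cliques, whose edges are the vertices of the configuration *)

Definition clique_type : finType := {C : {set X} | C \in GG}.
Implicit Types (P Q : clique_type).

Definition meet : rel clique_type :=
  fun P Q => (P != Q) && (val P :&: val Q != set0).

Lemma meet_sym : symmetric meet.
Proof. by move=> P Q; rewrite /meet eq_sym setIC. Qed.

Lemma meet_irrefl : irreflexive meet.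
Proof. by move=> P; rewrite /meet eqxx. Qed.

Lemma meetP P Q : reflect (exists u, [/\ P != Q, u \in val P & u \in val Q]) (meet P Q).
Proof.
apply: (iffP andP) => [[PQ /set0Pn[u /setIP[uP uQ]]]|[u [PQ uP uQ]]].
  by exists u.
by split=> //; apply/set0Pn; exists u; rewrite inE uP.
Qed.

(** Each vertex of [P] lies in exactly one further clique, and two vertices never in the same one,
    so at least nine cliques meet [P], more than a list of six can hold. *)
Lemma meet_degree P (s : seq clique_type) : size s <= 6 ->
  exists2 Q, meet P Q & Q \notin s.
Proof.
move=> ss; have [/existsP[Q /andP[PQ Qs]]|none] :=
  boolP [exists Q, meet P Q && (Q \notin s)]; first by exists Q.
have := large (valP P).
suff : #|val P| <= size s by lia.
rewrite -sum1_card.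
apply: (@leq_trans (\sum_(u in val P) \sum_(Q <- s | P != Q) (u \in val Q))).
  apply: leq_sum => u uP; have [D [DG uD PD]] := other_clique (valP P) uP.
  pose Q : clique_type := exist _ D DG.
  have PQ : P != Q by rewrite -val_eqE.
  have Qs : Q \in s.
    have := none; rewrite negb_exists => /forallP/(_ Q); rewrite negb_and negbK.
    by case/orP => // /negP[]; apply/meetP; exists u.
  by rewrite (big_rem Q Qs) /= PQ uD.
rewrite exchange_big /= -sum1_size [in leqLHS]big_mkcond.
apply: leq_sum => Q _; case: ifP => // PQ.
apply: (@leq_trans #|val P :&: val Q|).
  rewrite -sum1_card big_mkcond [in leqRHS]big_mkcond; apply: leq_sum => u _.
  by rewrite in_setI; case: (u \in val P); case: (u \in val Q).
by rewrite card_clique_cap ?(valP P) ?(valP Q) ?val_eqE ?PQ ?leq_b1.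
Qed.

(** The edges are non-adjacent vertices [u] and [v], whose common neighbors are the points where a
    clique at [u] meets a clique at [v]. *)
Lemma meet_cross P1 P2 Q1 Q2 : meet P1 P2 -> meet Q1 Q2 ->
  [/\ P1 != Q1, P1 != Q2, P2 != Q1 & P2 != Q2] ->
  meet P1 Q1 + meet P1 Q2 + meet P2 Q1 + meet P2 Q2 = mu d.
Proof.
case/meetP => u [P12 uP1 uP2] /meetP[v [Q12 vQ1 vQ2]] [h11 h12 h21 h22].
have notin Q : P1 != Q -> P2 != Q -> u \notin val Q.
  move=> n1 n2; apply/negP => uQ.
  have [] := third_clique (valP P1) (valP P2) P12 uP1 uP2 (valP Q) uQ.
    by move/val_inj => QP; rewrite QP eqxx in n1.
  by move/val_inj => QP; rewrite QP eqxx in n2.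
have cuv := cliques_non_nbr (valP Q1) (valP Q2) Q12 vQ1 vQ2
  (notin _ h11 h21) (notin _ h12 h22).
rewrite -(card_common_nbr cuv) (card_cliques_at geo (subsetIr (nbr u) (nbr v))).
rewrite (sum_pair _ (valP Q1) (valP Q2) Q12 vQ1 vQ2).
have capE Q : v \in val Q -> u \notin val Q ->
    #|val Q :&: (nbr u :&: nbr v)| = #|val Q :&: nbr u|.
  move=> vQ uQ; apply: eq_card => w; rewrite !in_setI.
  case: (boolP (w \in val Q)) => //= wQ; case: (boolP (w \in nbr u)) => //= uw.
  apply: (geometry_adj geo (valP Q) vQ wQ).
  by apply: contraTneq uw => <-; rewrite (nbrE nondominantE) cuv eqxx andbF.
rewrite !capE ?notin // !(card_clique_nbr (valP P1) (valP P2) P12 uP1 uP2) ?notin //;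
  try exact: valP.
by rewrite /meet h11 h12 h21 h22 /= addnACA !addnA.
Qed.

Lemma meet_graph : (forall P Q, P != Q -> meet P Q) \/
  exists side : pred clique_type, forall P Q, meet P Q = (side P != side Q).
Proof.
exact: cross_regular_graph meet_sym meet_irrefl mu_gt0 meet_degree meet_cross.
Qed.

Lemma card_clique_meet P : #|val P| = #|[set Q | meet P Q]|.
Proof.
transitivity (\sum_(u in val P) \sum_(Q | meet P Q) (u \in val Q)).
  rewrite -sum1_card; apply: eq_bigr => u uP.
  have [D [DG uD PD]] := other_clique (valP P) uP.
  pose Q : clique_type := exist _ D DG.
  have PQ : P != Q by rewrite -val_eqE.
  rewrite (bigD1 Q) /=; last by apply/meetP; exists u.
  rewrite uD big1 // => E /andP[/andP[PE _] EQ]; apply/eqP; rewrite eqb0.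
  apply/negP => uE; have [] := third_clique (valP P) DG PD uP uD (valP E) uE.
    by move/val_inj => EP; rewrite EP eqxx in PE.
  by move=> ED; move: EQ; rewrite -val_eqE /= ED eqxx.
rewrite exchange_big /= -sum1_card; apply: eq_big => Q; first by rewrite inE.
case/andP => PQ ne; have := card_clique_cap (valP P) (valP Q).
rewrite val_eqE => /(_ PQ); rewrite ne -sum1_card => /= <-.
rewrite big_mkcond [in RHS]big_mkcond; apply: eq_bigr => u _.
by rewrite in_setI; case: (u \in val P); case: (u \in val Q).
Qed.

(** A vertex is sent to the pair of cliques through it. This is injective because two cliques share
    at most one vertex, and surjective because adjacent cliques share one. *)
Lemma nondominant_graph_line_graph (K : sgraph) (h : clique_type -> K) :
  bijective h -> (forall P Q, sadj (h P) (h Q) = meet P Q) ->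
  sgraph_iso (nondominant_graph X) (line_graph K).
Proof.
move=> h_bij hE; have h_inj := bij_inj h_bij.
pose f0 u : {set K} := [set h P | P in [set P : clique_type | u \in val P]].
have mem_f0 u P : (h P \in f0 u) = (u \in val P).
  by rewrite mem_imset // inE.
have f0_pair u P Q : P != Q -> u \in val P -> u \in val Q -> f0 u = [set h P; h Q].
  move=> PQ uP uQ; apply/setP => x; have [g _ hK] := h_bij.
  rewrite -(hK x) mem_f0 !inE !(inj_eq h_inj).
  apply/idP/orP => [uE|[]/eqP-> //].
  by have [|] := third_clique (valP P) (valP Q) PQ uP uQ (valP (g x)) uE;
     move/val_inj => ->; [left|right].
have f0_edge u : f0 u \in edge_set K.
  have [C [D [CG DG CD uC uD]]] := geometry_at u.
  pose P : clique_type := exist _ C CG; pose Q : clique_type := exist _ D DG.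
  have PQ : P != Q by rewrite -val_eqE.
  apply/imsetP; exists (h P, h Q); last exact: f0_pair.
  by rewrite inE /= hE; apply/meetP; exists u.
pose f u : line_vertex K := exist _ (f0 u) (f0_edge u).
have f_inj : injective f.
  move=> u v /(congr1 val) /= f0E; have [C [D [CG DG CD uC uD]]] := geometry_at u.
  have memE E (EG : E \in GG) : u \in E -> v \in E.
    by rewrite -(mem_f0 u (exist _ E EG)) f0E mem_f0.
  by apply: (clique_cap_unique CG DG CD) => //; exact: memE.
exists f; last first.
  move=> u v; rewrite /= /line_adj (inj_eq f_inj) /nondominant_adj.
  case: (eqVneq u v) => //= uv.
  have -> : nondominant (color u v) = (v \in nbr u).
    by rewrite inE /nondominant_adj uv.
  apply/set0Pn/idP => [[x]|uv_adj].
    have [g _ hK] := h_bij; rewrite -(hK x) inE !mem_f0 => /andP[uE vE].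
    exact: (geometry_adj geo (valP (g x))).
  have [E [EG uE vE]] := geometry_clique geo uv_adj.
  by exists (h (exist _ E EG)); rewrite inE !mem_f0 uE.
apply: inj_card_bij => //.
have sub : {subset line_vertex K <= codom f}.
  move=> [e eK] _; have /imsetP[[x y]] := eK; rewrite inE /= => xy eE.
  have [g _ hK] := h_bij; move: xy; rewrite -(hK x) -(hK y) hE => /meetP[u [PQ uP uQ]].
  apply/codomP; exists u; apply: val_inj => /=.
  by rewrite eE (f0_pair _ _ _ PQ uP uQ) !hK.
apply: leq_trans (leq_image_card f xpredT); apply: subset_leq_card.
by apply/subsetP => e _; exact: sub.
Qed.

Lemma rank_nondominant (S : {set 'I_(rank X)}) :
  (forall j, nondominant j = (j \in S)) -> rank X = #|S| + 2.
Proof.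
move=> SE; have /card_gt0P[u _] : 0 < #|vertex X|.
  by have := valency_d; rewrite /nb_vertices; lia.
have zE := color_zeroE u.
apply: (etrans (esym (card_ord (rank X)))).
have -> : #|'I_(rank X)| = #|color u u |: (d |: S)|.
  rewrite -cardsT; congr #|pred_of_set _|; apply/setP => j.
  by rewrite !inE -SE nondominantE -zE; case: (j == 0 :> nat); case: (j == d).
have cd : (color u u == d) = false by rewrite eq_sym -zE (negbTE d_neq0).
by rewrite !cardsU1 !inE -!SE !nondominantE color_diag !eqxx cd /= andbF addnA addnC.
Qed.

Lemma rank_three_iso i (G : sgraph) : nondominant i ->
  (forall j, nondominant j -> j = i) -> sgraph_iso (nondominant_graph X) G ->
  rank X = 3 /\ configuration_iso X (graph_configuration G).
Proof.
move=> ndi onei [f f_bij fE].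
have r3 : rank X = 3.
  rewrite (@rank_nondominant [set i]) ?cards1 // => j; rewrite in_set1.
  by apply/idP/eqP => [/onei|->].
split=> //; exists f => //.
pose phi (j : 'I_(rank X)) : 'I_3 :=
  if j == 0 :> nat then inord 0 else if nondominant j then inord 1 else inord 2.
exists phi; last first.
  move=> u v /=; rewrite (inj_eq (bij_inj f_bij)) fE /phi color_diag.
  by rewrite /= /nondominant_adj; case: (u == v).
apply: inj_card_bij; last by rewrite !card_ord r3.
have phi_val j : phi j = (if j == 0 :> nat then 0 else if nondominant j then 1 else 2) :> nat.
  by rewrite /phi; case: ifP => _; [|case: ifP => _]; rewrite inordK.
move=> j k /(congr1 val); rewrite /= !phi_val.
case: eqP => j0; case: eqP => k0.
- by move=> _; apply: val_inj; rewrite /= j0 k0.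
- by case: ifP.
- by case: ifP.
case: (boolP (nondominant j)) => ndj; case: (boolP (nondominant k)) => ndk // _.
  by rewrite (onei j) // (onei k).
move: ndj ndk; rewrite !nondominantE; move/eqP: j0 => ->; move/eqP: k0 => -> /=.
by rewrite !negbK => /eqP-> /eqP->.
Qed.

Lemma card_cap_unique C D (S : {set X}) x : C \in GG -> D \in GG -> C != D ->
  x \in C -> x \in D -> #|C :&: (D :&: S)| = (x \in S).
Proof.
move=> CG DG CD xC xD; rewrite setIA.
have -> : C :&: D = [set x].
  apply/setP => y; rewrite in_set1; apply/setIP/eqP => [[yC yD]|->//].
  exact: (clique_cap_unique CG DG).
case: (boolP (x \in S)) => xS; first by rewrite (setIidPl _) ?sub1set // cards1.
by apply/eqP; rewrite cards_eq0 setI_eq0 disjoints1.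
Qed.

(** The neighbors of [u] in [C] lie in [A] or [B], so they are [x] and [y]. *)
Lemma triangle_color_count A B C u x y j :
  A \in GG -> B \in GG -> C \in GG -> A != B -> A != C -> B != C ->
  u \in A -> u \in B -> x \in A -> x \in C -> y \in B -> y \in C ->
  nondominant j ->
  #|C :&: color_neighbors j u| = (color u x == j) + (color u y == j).
Proof.
move=> AG BG CG AB AC BC uA uB xA xC yB yC ndj.
have sub : C :&: color_neighbors j u \subset nbr u.
  exact: subset_trans (subsetIr _ _) (color_neighbors_sub u ndj).
rewrite (card_cliques_at geo sub) (sum_pair _ AG BG AB uA uB).
by rewrite (card_cap_unique _ AG CG AC xA xC) (card_cap_unique _ BG CG BC yB yC) !inE.
Qed.

Lemma nondominant_clique C u v : C \in GG -> u \in C -> v \in C -> u != v ->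
  nondominant (color u v).
Proof. by move=> CG uC vC uv; exact: nbr_nondominant (geometry_adj geo CG uC vC uv). Qed.

Lemma card_nbr_pair u C D : C \in GG -> D \in GG -> C != D ->
  u \in C -> u \in D -> rho X + 2 = #|C| + #|D|.
Proof.
move=> CG DG CD uC uD.
rewrite -(card_nbr d_neq0 valency_d nondominantE u).
rewrite (card_cliques_at geo (subxx (nbr u))) (sum_pair _ CG DG CD uC uD).
have capE E : E \in GG -> u \in E -> #|E| = #|E :&: nbr u|.+1.
  move=> EG uE; rewrite (cardsD1 u) uE add1n; congr _.+1; apply: eq_card => v.
  rewrite in_setD1 in_setI andbC; case: (boolP (v \in E)) => //= vE.
  case: (eqVneq v u) => [->|vu]; first by rewrite (nbrE nondominantE) eqxx.
  by apply/esym/(geometry_adj geo EG uE vE); rewrite eq_sym.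
by rewrite (capE C) // (capE D) // addn2 addSn addnS.
Qed.

Lemma color_neq_nondominant u v i : nondominant i -> color u v = i -> u != v.
Proof. by move=> ndi /(mem_nbr ndi)/nbr_neq. Qed.

(** * All cliques meet: triangular graphs *)

Section Complete.
Hypothesis meet_complete : forall P Q, P != Q -> meet P Q.

Lemma complete_triangular_iso :
  sgraph_iso (nondominant_graph X) (triangular_graph #|clique_type|).
Proof.
apply: (nondominant_graph_line_graph (K := complete_graph _) (@enum_rank_bij _)).
move=> P Q; rewrite /= (inj_eq enum_rank_inj).
by case: (eqVneq P Q) => [->|/meet_complete->//]; rewrite meet_irrefl.
Qed.

(* Three cliques avoiding [u] meet pairwise, and the counts at the three
   intersection points determine the individual terms. *)
Lemma complete_color_count u P j : u \notin val P -> nondominant j ->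
  2 * #|val P :&: color_neighbors j u| = nbr_count d j.
Proof.
move=> uP ndj; have [C [D [CG DG CD uC uD]]] := geometry_at u.
pose A : clique_type := exist _ C CG; pose B : clique_type := exist _ D DG.
have notin Q : Q != A -> Q != B -> u \notin val Q.
  move=> QA QB; apply/negP => uQ.
  have [E|E] := third_clique CG DG CD uC uD (valP Q) uQ.
    by move: QA; rewrite -val_eqE /= E eqxx.
  by move: QB; rewrite -val_eqE /= E eqxx.
have [Q PQ] := meet_degree P (s := [:: A; B]) isT.
rewrite !inE negb_or => /andP[QA QB].
have [R PR] := meet_degree P (s := [:: A; B; Q]) isT.
rewrite !inE !negb_or => /and3P[RA RB RQ].
have split S T : meet S T -> u \notin val S -> u \notin val T ->
    nbr_count d j = #|val S :&: color_neighbors j u| + #|val T :&: color_neighbors j u|.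
  case/meetP => v [ST vS vT] uS uT.
  exact: (nbr_count_split (valP S) (valP T) ST vS vT uS uT ndj).
have := split _ _ PQ uP (notin _ QA QB); have := split _ _ PR uP (notin _ RA RB).
have := split _ _ (meet_complete RQ) (notin _ RA RB) (notin _ QA QB).
move: #|_| #|_| #|_| (nbr_count d j) => a b c e; clear; lia.
Qed.

Lemma card_clique_complete P : #|val P|.+1 = #|clique_type|.
Proof.
rewrite card_clique_meet (_ : [set Q | meet P Q] = [set~ P]).
  by rewrite cardsC1 prednK //; apply/card_gt0P; exists P.
apply/setP => Q; rewrite !inE.
by case: (eqVneq Q P) => [->|QP]; rewrite ?meet_irrefl // meet_complete // eq_sym.
Qed.

Lemma complete_case :
  (rank X = 3 /\ exists m,
     configuration_iso X (graph_configuration (triangular_graph m))) \/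
  (rank X = 4 /\ exists i : 'I_(rank X),
     [/\ nondominant i, ~~ symmetric_color i &
         sgraph_iso (nondominant_graph X) (triangular_graph (valency i + 2))]).
Proof.
have /card_gt0P[u _] : 0 < #|vertex X|.
  by have := valency_d; rewrite /nb_vertices; lia.
have [C [D [CG DG CD uP uQ]]] := geometry_at u.
pose P : clique_type := exist _ C CG; pose Q : clique_type := exist _ D DG.
have PQ : P != Q by rewrite -val_eqE.
(* A third clique [R] meets [P] and [Q] in [x] and [y]: this is a triangle [u x y] not contained in
   a clique of the geometry. *)
have [R PR] := meet_degree P (s := [:: Q]) isT; rewrite inE => RQ.
have QR : val Q != val R by rewrite val_eqE eq_sym.
have [x [PR' xP xR]] := meetP _ _ PR.
have /meetP[y [_ yQ yR]] : meet Q R by apply: meet_complete; rewrite eq_sym.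
have uR : u \notin val R.
  apply/negP => uR; have [E|E] := third_clique CG DG CD uP uQ (valP R) uR.
    by move: PR'; rewrite -val_eqE /= E eqxx.
  by move: RQ; rewrite -val_eqE /= E eqxx.
have ux : u != x by apply: contraNneq uR => ->.
have uy : u != y by apply: contraNneq uR => ->.
have xy : x != y.
  by apply: contraNneq ux => xy; rewrite (clique_cap_unique CG DG CD uP uQ xP) // xy.
have yP : y \notin val P.
  by apply/negP => yP; move/negP: uy; apply; rewrite (clique_cap_unique CG DG CD uP uQ yP yQ).
have xQ : x \notin val Q.
  by apply/negP => xQ; move/negP: ux; apply; rewrite (clique_cap_unique CG DG CD uP uQ xP xQ).
have ndux : nondominant (color u x) := nondominant_clique CG uP xP ux.
have nduy : nondominant (color u y) := nondominant_clique DG uQ yQ uy.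
have count_u j : nondominant j ->
    2 * ((color u x == j) + (color u y == j)) = nbr_count d j.
  move=> ndj; rewrite -(complete_color_count uR ndj).
  by rewrite (triangle_color_count CG DG (valP R) CD PR' QR uP uQ xP xR yQ yR ndj).
(* The color [j] occurs in [P] at some [z], so it is counted in the other clique through [z], which
   misses [u]. Hence [nbr_count d j] is positive, and by [count_u] the color is that of [ux] or
   [uy]. *)
have two_colors j : nondominant j -> j = color u x \/ j = color u y.
  move=> ndj; have /clique_colorP[z zP cuz] := all_colors CG uP ndj.
  have [E [EG zE PE]] := other_clique CG zP.
  have uE : u \notin E.
    apply/negP => uE; have := color_neq_nondominant ndj cuz.
    by rewrite (clique_cap_unique CG EG PE uP uE zP zE) eqxx.
  have := @complete_color_count u (exist _ E EG) j uE ndj.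
  have : 0 < #|E :&: color_neighbors j u|.
    by apply/card_gt0P; exists z; rewrite !inE zE cuz eqxx.
  rewrite -(count_u j ndj) /=.
  case: (eqVneq (color u x) j) => [->|_]; first by left.
  case: (eqVneq (color u y) j) => [->|_]; first by right.
  by move=> + H; rewrite -(ltn_pmul2l (isT : 0 < 2)) H.
have [cE|cN] := eqVneq (color u x) (color u y).
  left; have one j : nondominant j -> j = color u x.
    by move=> ndj; have [|->] := two_colors j ndj.
  have [r3 iso] := rank_three_iso ndux one complete_triangular_iso.
  by split=> //; exists #|clique_type|.
(* If [color u x] were symmetric, so would be [color u y]. Then the count at [x] in [Q] forces
   [color x y = color u y], while the count at [y] in [P] forces [color y x] to differ from it. *)
right; have nonsym : star (color u x) != color u x.
  apply/negP => /eqP starx.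
  have nduxs : nondominant (color x u) by rewrite (color_swap u x) starx.
  have ndxy : nondominant (color x y) := nondominant_clique (valP R) xR yR xy.
  have stary : star (color u y) = color u y.
    have ndyu : nondominant (color y u) by apply: (nondominant_clique DG yQ uQ); rewrite eq_sym.
    have [] := two_colors _ ndyu; rewrite color_swap // => E.
    by move: cN; rewrite [color u y]color_swap [color y u]color_swap E starx eqxx.
  have QP : val Q != val P by rewrite eq_sym.
  have RP : val R != val P by rewrite val_eqE eq_sym.
  have count_x := triangle_color_count CG (valP R) DG PR' CD RQ xP xR uP uQ yR yQ nduy.
  have count_y := triangle_color_count DG (valP R) CG QR QP RP yQ yR uQ uP xR xP nduy.
  have := complete_color_count xQ nduy; have := complete_color_count yP nduy.
  rewrite count_x count_y -(count_u _ nduy) eqxx (negbTE cN).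
  rewrite (color_swap u x) starx (negbTE cN) (color_swap u y) stary eqxx.
  rewrite (color_swap x y); case: (eqVneq (color x y) (color u y)) => // ->.
  by rewrite stary eqxx.
have starE : star (color u x) = color u y.
  have ndxu : nondominant (color x u) by apply: (nondominant_clique CG xP uP); rewrite eq_sym.
  have [] := two_colors _ ndxu; rewrite (color_swap u x) // => E.
  by rewrite E eqxx in nonsym.
have SE j : nondominant j = (j \in [set color u x; color u y]).
  by rewrite !inE; apply/idP/orP => [/two_colors[]->|[]/eqP-> //]; rewrite eqxx; [left|right].
have r4 : rank X = 4 by rewrite (rank_nondominant SE) cards2 cN.
split=> //; exists (color u x); split=> //.
suff -> : valency (color u x) + 2 = #|clique_type| by exact: complete_triangular_iso.
have valE : valency (color u y) = valency (color u x).
  by rewrite -starE -color_swap valency_color_sym.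
have nbr_card : rho X = valency (color u x) + valency (color u y).
  rewrite -(card_nbr d_neq0 valency_d nondominantE u) -!(valencyE _ u).
  rewrite -cardsUI (_ : _ :&: _ = set0) ?cards0 ?addn0.
    apply: eq_card => v; rewrite !inE /nondominant_adj SE !inE.
    case: (eqVneq u v) => //= <-.
    have neq0 z : nondominant (color u z) -> (color u u == color u z) = false.
      by case/andP => /negbTE cz0 _; rewrite eq_sym -color_zeroE.
    by rewrite !neq0.
  apply/setP => v; rewrite !inE; apply/negbTE.
  by apply: contraNN cN => /andP[/eqP-> /eqP->].
(* [rho] is twice the valency and also [#|C| + #|D| - 2], where both cliques have one vertex less
   than there are cliques. *)
have := card_nbr_pair CG DG CD uP uQ.
have := card_clique_complete P; have := card_clique_complete Q.
rewrite nbr_card valE /=; move: #|C| #|D| #|_| (valency _) => a b c v; clear; lia.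
Qed.
End Complete.

(** * Cliques on two sides: lattice graphs *)

Section Bipartite.
Variable side : pred clique_type.
Hypothesis meet_side : forall P Q, meet P Q = (side P != side Q).

(** Fix a clique [D] other than [Q] through a vertex of [Q] other than [u]. For [z] in [P], the
    other clique [C] at [z] meets [D] but not [Q], so [nbr_count d j] is the indicator of
    [color u z = j] plus a term from [D] that does not depend on [z]. *)
Lemma bipartite_color_const P Q u x x' : P != Q -> u \in val P -> u \in val Q ->
  x \in val P -> x' \in val P -> u != x -> u != x' -> color u x = color u x'.
Proof.
move=> PQ uP uQ xP x'P ux ux'.
have mPQ : meet P Q by apply/meetP; exists u.
have /card_gt0P[y] : 0 < #|val Q :\ u|.
  by have := large (valP Q); have := cardsD1 u (val Q); rewrite uQ /=; lia.
rewrite in_setD1 eq_sym => /andP[uy yQ].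
have other (R : clique_type) z : z \in val R -> exists S, [/\ meet R S, R != S & z \in val S].
  move=> zR; have [E [EG zE RE]] := other_clique (valP R) zR.
  by exists (exist _ E EG); split=> //; apply/meetP; exists z; rewrite -val_eqE.
have [D [mQD QD yD]] := other Q y yQ.
have uD : u \notin val D.
  apply/negP => uD; move: uy.
  by rewrite (clique_cap_unique (valP Q) (valP D) QD uQ uD yQ yD) eqxx.
have ndj : nondominant (color u x) := nondominant_clique (valP P) uP xP ux.
set j := color u x in ndj *.
have count z : z \in val P -> u != z ->
    nbr_count d j = (color u z == j) + #|val D :&: color_neighbors j u|.
  move=> zP uz; have [C [mPC PC zC]] := other P z zP.
  have uC : u \notin val C.
    apply/negP => uC; move: uz.
    by rewrite (clique_cap_unique (valP P) (valP C) PC uP uC zP zC) eqxx.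
  have /meetP[v [CD vC vD]] : meet C D.
    move: mPC mQD mPQ; rewrite !meet_side.
    by do 4!case: (side _).
  rewrite (nbr_count_split (valP C) (valP D) CD vC vD uC uD ndj); congr (_ + _).
  have sub : val C :&: color_neighbors j u \subset nbr u.
    exact: subset_trans (subsetIr _ _) (color_neighbors_sub u ndj).
  rewrite (card_cliques_at geo sub) (sum_pair _ (valP P) (valP Q) PQ uP uQ).
  rewrite (card_cap_unique _ (valP P) (valP C) PC zP zC) inE.
  rewrite setIA (_ : val Q :&: val C = set0) ?set0I ?cards0 ?addn0 //.
  apply/eqP; apply/negPn/negP => QC.
  have : meet Q C.
    rewrite /meet QC andbT; apply: contraNneq uC => <-; exact: uQ.
  by move: mPC mPQ; rewrite !meet_side; do 3!case: (side _).
have := count x xP ux; rewrite (count x' x'P ux') /j eqxx => /addIn.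
by case: eqP.
Qed.

Lemma bipartite_one_color i j : nondominant i -> nondominant j -> i = j.
Proof.
move=> ndi ndj; have /card_gt0P[u _] : 0 < #|vertex X|.
  by have := valency_d; rewrite /nb_vertices; lia.
have [C [D [CG DG CD uC uD]]] := geometry_at u.
have /clique_colorP[x xC cux] := all_colors CG uC ndi.
have /clique_colorP[y yC cuy] := all_colors CG uC ndj.
rewrite -cux -cuy; apply: (@bipartite_color_const (exist _ C CG) (exist _ D DG) u) => //.
  exact: color_neq_nondominant ndi cux.
exact: color_neq_nondominant ndj cuy.
Qed.

(** A bipartite graph has no triangles, so the common neighbors of two vertices of [P] all lie in
    [P]; their number depends on the color only, and all cliques have the same size. *)
Lemma bipartite_card_clique P i : nondominant i -> #|val P| = nbr_count i i + 2.
Proof.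
move=> ndi; have /card_gt0P[u uP] : 0 < #|val P| by have := large (valP P); lia.
have [D [DG uD PD]] := other_clique (valP P) uP.
have /clique_colorP[x xP cux] := all_colors (valP P) uP ndi.
have ux := color_neq_nondominant ndi cux.
have [E [EG xE PE]] := other_clique (valP P) xP.
have nbr_i : color_neighbors i u = nbr u.
  apply/setP => v; apply/idP/idP; first exact: (subsetP (color_neighbors_sub u ndi)).
  by move=> /nbr_nondominant nduv; rewrite inE (bipartite_one_color nduv ndi).
rewrite -[X in nbr_count X _]cux -nbr_countE nbr_i.
rewrite (card_cliques_at geo (subsetIl (nbr u) (nbr x))).
rewrite (sum_pair _ (valP P) DG PD uP uD).
rewrite (_ : D :&: _ = set0).
  rewrite cards0 addn0 (cardsD1 u) uP (cardsD1 x) in_setD1 eq_sym ux xP /=.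
  rewrite add1n add1n addn2; congr _.+2; apply: eq_card => v.
  rewrite !in_setD1 !in_setI; case: (boolP (v \in val P)) => vP; rewrite ?andbF //.
  case: (eqVneq v u) => [->|vu]; first by rewrite (nbrE nondominantE) eqxx andbF.
  case: (eqVneq v x) => [->|vx]; first by rewrite (nbrE nondominantE x) eqxx andbF.
  rewrite (geometry_adj geo (valP P) uP vP) 1?eq_sym //.
  by rewrite (geometry_adj geo (valP P) xP vP) 1?eq_sym.
apply/eqP; rewrite -subset0; apply/subsetP => z.
rewrite !in_setI => /and3P[zD uz xz].
have [F [FG xF zF]] := geometry_clique geo xz.
have uz' := nbr_neq uz.
have [EF|EF] := third_clique (valP P) EG PE xP xE FG xF; subst F.
  by rewrite (clique_cap_unique (valP P) DG PD uP uD zF zD) eqxx in uz'.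
have DE : D != E.
  by apply: contraNneq ux => DE; rewrite (clique_cap_unique (valP P) DG PD uP uD xP) // DE.
have /= := meet_side (exist _ D DG) (exist _ E EG).
have : meet P (exist _ D DG) by apply/meetP; exists u; rewrite -val_eqE.
have : meet P (exist _ E EG) by apply/meetP; exists x; rewrite -val_eqE.
have -> : meet (exist _ D DG) (exist _ E EG).
  by apply/meetP; exists z; rewrite -val_eqE.
by rewrite !meet_side; do 3!case: (side _).
Qed.

(** A clique meets each clique of the other side in one vertex, so the constant clique size is the
    size of both sides. *)
Lemma bipartite_case i : nondominant i ->
  rank X = 3 /\ exists m,
    configuration_iso X (graph_configuration (lattice_graph m)).
Proof.
move=> ndi; have /card_gt0P[u _] : 0 < #|vertex X|.
  by have := valency_d; rewrite /nb_vertices; lia.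
have [C [D [CG DG CD uC uD]]] := geometry_at u.
pose P0 : clique_type := exist _ C CG; pose Q0 : clique_type := exist _ D DG.
have mPQ : meet P0 Q0 by apply/meetP; exists u; rewrite -val_eqE.
pose L := [set P | side P]; pose M := [set P | ~~ side P].
have cardP P : #|if side P then M else L| = nbr_count i i + 2.
  rewrite -(bipartite_card_clique P ndi) card_clique_meet; apply: eq_card => Q.
  by rewrite inE meet_side; case: (side P); rewrite !inE; case: (side Q).
have [P [Q [PL QM]]] : exists P Q, P \in L /\ Q \in M.
  move: mPQ; rewrite meet_side; case: (boolP (side P0)) => sP sQ.
    by exists P0, Q0; rewrite !inE sP; case: (side Q0) sQ.
  by exists Q0, P0; rewrite !inE sP; case: (side Q0) sQ.
have LM : #|M| = #|L|.
  have := cardP P; have := cardP Q; move: PL QM; rewrite !inE => -> /negbTE->.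
  by move=> -> ->.
pose h R : complete_bipartite_graph #|L| :=
  if side R then inl (enum_rank_in PL R) else inr (cast_ord LM (enum_rank_in QM R)).
have h_inj : injective h.
  move=> R S; rewrite /h; case: ifP => sR; case: ifP => sS // -[].
    by move=> E; apply: (can_in_inj (enum_rankK_in PL)) => //; rewrite inE.
  by move/val_inj => E; apply: (can_in_inj (enum_rankK_in QM)) => //;
     rewrite inE ?sR ?sS.
have h_bij : bijective h.
  apply: inj_card_bij => //=; rewrite card_sum !card_ord -{2}LM -cardsUI.
  rewrite (_ : L :&: M = set0) ?cards0 ?addn0 ?max_card //.
  by apply/setP => R; rewrite !inE andbN.
have hE R S : sadj (h R) (h S) = meet R S.
  by rewrite /= /biadj /h meet_side; case: (side R); case: (side S).
have [r3 iso] := rank_three_iso ndi (fun j ndj => bipartite_one_color ndj ndi)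
  (nondominant_graph_line_graph h_bij hE).
by split=> //; exists #|L|.
Qed.
End Bipartite.
End TwoCliques.

(** * The classification of a single configuration under explicit bounds *)

Lemma exceptional_geometry (X : pcc) (GG : {set {set X}}) (i0 : 'I_(rank X)) :
  8 <= nb_vertices X -> 400 * rho X ^ 3 <= nb_vertices X ^ 2 ->
  clique_geometry GG -> nondominant i0 ->
  (forall (C : {set X}) u (i : 'I_(rank X)), C \in GG -> u \in C -> nondominant i ->
     clique_color C u i ->
     9 * lambda i <= 10 * #|C :&: color_neighbors i u| <= 11 * lambda i) ->
  (exists u, #|cliques_at GG u| <= 2) ->
  (rank X = 3 /\ exists m,
     configuration_iso X (graph_configuration (triangular_graph m)) \/
     configuration_iso X (graph_configuration (lattice_graph m))) \/
  (rank X = 4 /\ exists i : 'I_(rank X),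
     [/\ nondominant i, ~~ symmetric_color i &
         sgraph_iso (nondominant_graph X) (triangular_graph (valency i + 2))]).
Proof.
move=> n8 rho3 geo nd_i0 uniform [u0 u0_le2].
(* If [n < 4 r], then [400 r^3 <= n^2 <= 16 r^2] with [r > 0], which is absurd. *)
have rho4 : 4 * rho X <= nb_vertices X.
  move: n8 rho3; rewrite !expnS !expn0 !muln1.
  move: (rho X) (nb_vertices X) => r n n8 rho3; rewrite leqNgt; apply/negP => nr.
  have nn : n * n <= 16 * (r * r) by nia.
  have r_gt0 : 0 < r * r by rewrite muln_gt0; lia.
  have : r * r * (400 * r) <= r * r * 16 by lia.
  by rewrite leq_pmul2l //; lia.
have [d [d_neq0 valency_d nondominantE]] := dominant_color n8 rho4.
have d_gt0 : 0 < valency d by lia.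
have mugt0 := mu_gt0 d_neq0 valency_d nondominantE d_gt0 nd_i0.
have n4 : 4 <= nb_vertices X by lia.
have musmall (i : 'I_(rank X)) (ndi : nondominant i) : 100 * mu d <= valency i.
  exact: (mu_small d_neq0 valency_d nondominantE rho4 n4 rho3 ndi).
have two u : #|cliques_at GG u| = 2.
  exact: (card_cliques_at_eq2 geo d_neq0 valency_d nondominantE d_gt0 nd_i0 musmall
    uniform u0_le2 u).
have all_colors (C : {set X}) u (i : 'I_(rank X)) : C \in GG -> u \in C -> nondominant i -> clique_color C u i.
  exact: (geometry_all_colors geo d_neq0 valency_d nondominantE d_gt0 nd_i0 musmall
    uniform u0_le2).
have ge9 (C : {set X}) : C \in GG -> 9 <= #|C|.
  move=> CG; have /card_gt0P[w _] : 0 < #|vertex X| by move: n8; rewrite /nb_vertices; lia.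
  have [u uC] : exists u, u \in C.
    by case: (boolP (w \in C)) => [wC|/(geometry_max geo CG)[c []]]; [exists w | exists c].
  exact: (card_geometry_ge geo d_neq0 valency_d nondominantE d_gt0 nd_i0 musmall
    uniform u0_le2 CG uC).
have [complete|[side meet_side]] :=
  meet_graph geo d_neq0 valency_d nondominantE mugt0 two ge9.
  have [[r3 [m iso]]|r4] := complete_case geo d_neq0 valency_d nondominantE mugt0 two
    all_colors ge9 complete; last by right.
  by left; split=> //; exists m; left.
have [r3 [m iso]] := bipartite_case geo d_neq0 valency_d nondominantE mugt0 two
  all_colors ge9 meet_side nd_i0.
by left; split=> //; exists m; right.
Qed.

(* From the asymptotic hypotheses to the explicit bounds *)
From mathcomp Require Import all_classical all_reals all_analysis.
Import Order.TTheory GRing.Theory Num.Theory numFieldNormedType.Exports.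

Local Open Scope classical_set_scope.
Local Open Scope ring_scope.

(** Cubing [8 r < n^(2/3)] gives [512 r^3 <= n^2]. *)
Lemma rho_cube_le (R : realType) (n r : nat) : (0 < n)%N ->
  r%:R / n%:R `^ (2 / 3) < 8^-1 :> R -> (400 * r ^ 3 <= n ^ 2)%N.
Proof.
move=> n_gt0; set p := n%:R `^ (2 / 3).
have p_gt0 : 0 < p by rewrite powR_gt0 ?ltr0n.
have p3 : p ^+ 3 = (n ^ 2)%:R.
  rewrite -powR_mulrn ?powR_ge0 // /p -powRrM divfK ?pnatr_eq0 //.
  by rewrite powR_mulrn ?ler0n // natrX.
rewrite ltr_pdivrMr // => rp.
have : (8 * r%:R) ^+ 3 <= p ^+ 3 :> R.
  by rewrite lerXn2r ?nnegrE ?mulr_ge0 ?ler0n ?ltW //; lra.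
rewrite p3 exprMn -!natrX -natrM ler_nat; apply: leq_trans.
by rewrite leq_mul2r orbT.
Qed.

Lemma deviation_bounds (R : realType) (a l : nat) :
  `|a%:R / l%:R - 1| < 10^-1 :> R -> (9 * l <= 10 * a <= 11 * l)%N.
Proof.
(* For [l = 0] the quotient is 0 by convention and the deviation is 1, which is too large. *)
have [->|l_gt0] := posnP l.
  rewrite invr0 mulr0 sub0r normrN1 => h; exfalso; move: h; lra.
rewrite ltr_norml => /andP[lo hi].
have lR : 0 < l%:R :> R by rewrite ltr0n.
have {}lo : 9 / 10 < a%:R / l%:R :> R by lra.
have {}hi : a%:R / l%:R < 11 / 10 :> R by lra.
rewrite ltr_pdivlMr // in lo; rewrite ltr_pdivrMr // in hi.
by rewrite -!(ler_nat R) !natrM; apply/andP; split; lra.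
Qed.

Theorem theorem2p5 (R : realType) (X : nat -> pcc)
    (GG : forall t, {set {set X t}})
    (n_infty : (nb_vertices (X t))%:R @[t --> \oo] --> (+oo : set_system R))
    (rho_small :
       (rho (X t))%:R / (nb_vertices (X t))%:R `^ (2 / 3) @[t --> \oo]
         --> (0 : R))
    (geometry : forall t, clique_geometry (GG t))
    (uniform : asymptotically_uniform R GG)
    (two_cliques : forall t, exists v : X t, (#|cliques_at (GG t) v| <= 2)%N) :
  \forall t \near \oo,
    (rank (X t) = 3%N /\
       exists m : nat,
         configuration_iso (X t) (graph_configuration (triangular_graph m)) \/
         configuration_iso (X t) (graph_configuration (lattice_graph m)))
    \/
    (rank (X t) = 4%N /\
       exists i : 'I_(rank (X t)),
         [/\ nondominant i, ~~ symmetric_color i &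
             sgraph_iso (nondominant_graph (X t))
                        (triangular_graph (valency i + 2))]).
Proof.
have [dev [dev_max dev0]] := uniform.
near=> t.
have n8 : (8 <= nb_vertices (X t))%N.
  by rewrite -(ler_nat R); near: t; exact: cvgry_ge.
have rho3 : (400 * rho (X t) ^ 3 <= nb_vertices (X t) ^ 2)%N.
  apply: (@rho_cube_le R); first by apply: leq_trans n8.
  by near: t; apply: cvgr_lt rho_small _ _; rewrite invr_gt0.
have [dev_t dev_ub] : is_maximum (uniformity_deviations (GG t)) (dev t) by near: t.
have dev_lt : dev t < 10^-1 by near: t; apply: cvgr_lt dev0 _ _; rewrite invr_gt0.
(* The maximum is attained, and this provides a nondominant color. *)
have [_ [_ [i [_ _ ndi _ _]]]] := dev_t.
apply: (exceptional_geometry n8 rho3 (geometry t) ndi) => // C u j CG uC ndj Cj.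
apply: (@deviation_bounds R); apply: le_lt_trans dev_lt.
by apply: dev_ub; exists C, u, j.
Unshelve. all: by end_near.
Qed.
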